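(* Let $A$ be a finite-dimensional unital associative algebra over a field $k$ with a non-degenerate, symmetric, invariant bilinear form $\eta$. Then the Hochschild cohomology $HH^*(A,A)$ is a BV algebra, such that the induced bracket is the Gerstenhaber bracket.
   Context: $\eta:A\otimes A\to k$ is invariant if $\eta(ab,c)=\eta(a,bc)$ and symmetric if $\eta(a,b)=\eta(b,a)$. $CH^n(A,A)=Hom(A^{\otimes n},A)$ with Hochschild differential; $HH^*(A,A)$ is its cohomology, which may be computed by normalized cochains $\overline{CH}^n(A,A)$, those vanishing on any tensor containing $1\in A$ as a factor. The product on $HH^*(A,A)$ is the cup product. The BV operator $\Delta$, of degree $-1$, is induced by the operator on $\overline{CH}^n(A,A)$ determined by $$\eta(a_0,(\Delta f)(a_1,\dots,a_{n-1}))=\eta(1,f\circ N(a_0,\dots,a_{n-1})),$$ where $N=1+t+\dots+t^{n-1}$ and $t(a_1,\dots,a_n)=(-1)^{n-1}(a_n,a_1,\dots,a_{n-1})$ on $A^{\otimes n}$ (the dual of Connes' operator $B$). A BV algebra is a graded commutative associative algebra with an operator $\Delta$ (here of degree $-1$), $\Delta^2=0$, satisfying $$\Delta(abc)=\Delta(ab)c+(-1)^{|a|}a\Delta(bc)+(-1)^{(|a|+1)|b|}b\Delta(ac)-\Delta(a)bc-(-1)^{|a|}a\Delta(b)c-(-1)^{|a|+|b|}ab\Delta(c).$$ Its induced bracket is the deviation of $\Delta$ from being a derivation, $\{a,b\}=(-1)^{|a|}\big(\Delta(ab)-\Delta(a)b-(-1)^{|a|}a\Delta(b)\big)$. The Gerstenhaber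 bracket is induced by $f\circ g-(-1)^{(|f|+1)(|g|+1)}g\circ f$, where $f\circ g$ is the signed sum of all insertions of $g$ into $f$. The equality of brackets is understood up to the usual universal sign conventions (a sign depending only on the degrees). *)

(* Defs.v *)
From HB Require Import structures.
From mathcomp Require Import all_boot all_algebra.
From mathcomp Require Import falgebra sesquilinear boolp functions.

Set Implicit Arguments.
Unset Strict Implicit.
Unset Printing Implicit Defensive.

Import GRing.Theory.
Local Open Scope ring_scope.
Local Open Scope quotient_scope.

Section QuotientModule.
Variables (R : pzRingType) (V : lmodType R) (W : submodClosed V).

Fact submod_zmod_closed : zmod_closed W.
Proof. exact: GRing.submod_closedB (submodClosedP W). Qed.

Definition submod_zmodClosed : zmodClosed V :=
  HB.pack (GRing.SubmodClosed.sort W)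
    (GRing.isZmodClosed.Build V (GRing.SubmodClosed.sort W) submod_zmod_closed).

Definition lmod_quot : Type := Quotient.quot submod_zmodClosed.
HB.instance Definition _ := GRing.Zmodule.on lmod_quot.
HB.instance Definition _ :=
  EqQuotient.copy lmod_quot (Quotient.quot submod_zmodClosed).

Lemma lmod_quotE (u v : V) :
  (\pi_lmod_quot u == \pi_lmod_quot v) = (u - v \in W).
Proof. exact/esym/(Quotient.idealrBE submod_zmodClosed). Qed.

Definition quot_scale (a : R) (x : lmod_quot) : lmod_quot :=
  \pi_lmod_quot (a *: repr x).

Lemma pi_scale (a : R) (v : V) :
  quot_scale a (\pi_lmod_quot v) = \pi_lmod_quot (a *: v).
Proof.
by apply/eqP; rewrite lmod_quotE -scalerBr rpredZ // -lmod_quotE reprK.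
Qed.

Lemma pi_addE (u v : V) :
  \pi_lmod_quot u + \pi_lmod_quot v = \pi_lmod_quot (u + v).
Proof. by rewrite (Quotient.pi_add submod_zmodClosed). Qed.

Fact quot_scaleA a b x : quot_scale a (quot_scale b x) = quot_scale (a * b) x.
Proof. by rewrite -[x]reprK (pi_scale b) !pi_scale scalerA. Qed.

Fact quot_scale1 : left_id 1 quot_scale.
Proof. by move=> x; rewrite -[x]reprK pi_scale scale1r. Qed.

Fact quot_scaleDr : right_distributive quot_scale +%R.
Proof.
by move=> a x y; rewrite -[x]reprK -[y]reprK pi_addE !pi_scale pi_addE scalerDr.
Qed.

Fact quot_scaleDl x : {morph quot_scale^~ x : a b / a + b}.
Proof. by move=> a b; rewrite -[x]reprK !pi_scale pi_addE scalerDl. Qed.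

HB.instance Definition _ := GRing.Zmodule_isLmodule.Build R lmod_quot
  quot_scaleA quot_scale1 quot_scaleDr quot_scaleDl.

End QuotientModule.

(* A map f : seq A -> A whose restriction to the words of each length n is    *)
(* n-linear is a family of elements of CH^n = Hom(A^{(x) n}, A). It lies in   *)
(* the direct sum of the CH^n when it also vanishes on all long words; CH^n   *)
(* itself consists of the multilinear maps vanishing on words of length != n. *)
(* All operations below are written on such families.                         *)
Section Cochains.
Variables (k : fieldType) (A : falgType k).
Implicit Types f g : seq A -> A.

Definition multilinear f :=
  forall (s t : seq A) (c : k) (x y : A),
    f (s ++ (c *: x + y) :: t) = c *: f (s ++ x :: t) + f (s ++ y :: t).

Definition cochain f :=
  multilinear f /\ exists N, forall s, (N <= size s)%N -> f s = 0.

Definition homogeneous (n : nat) f := forall s, size s != n -> f s = 0.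

Definition normalized f := forall s, 1 \in s -> f s = 0.

Definition hochschild f : seq A -> A := fun s =>
  if s is a :: s' then
    a * f s'
    + \sum_(i < size s')
        (-1) ^+ i.+1 *: f (take i s ++ (s`_i * s`_i.+1) :: drop i.+2 s)
    + (-1) ^+ size s *: (f (belast a s') * last a s')
  else 0.

Definition cup f g : seq A -> A := fun s =>
  \sum_(i < (size s).+1) f (take i s) * g (drop i s).

(* f o g for g of degree n *)
Definition circ (n : nat) f g : seq A -> A := fun s =>
  \sum_(i < (size s).+1 | (i + n <= size s)%N)
     (-1) ^+ (i * n.+1) *:
       f (take i s ++ g (take n (drop i s)) :: drop (i + n) s).

Definition gerstenhaber (m n : nat) f g : seq A -> A :=
  circ n f g - (-1) ^+ (m.+1 * n.+1) *: circ m g f.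

(* f o N, where t^i (a_1, ..., a_n) is (-1)^(i(n-1)) times the i-th right     *)
(* rotation of (a_1, ..., a_n)                                                *)
Definition cyclic_sum f : seq A -> A := fun s =>
  \sum_(i < size s) (-1) ^+ (i * (size s).-1) *: f (rotr i s).

(* g = Delta f; the part of f of degree 0 plays no role, so Delta is 0 on it. *)
Definition BV_dual (eta : A -> A -> k) f g :=
  forall (a0 : A) (s : seq A),
    eta a0 (g s) = eta 1 (cyclic_sum f (a0 :: s)).

Definition cocycle : pred (seq A -> A) :=
  [pred f | `[< cochain f /\ hochschild f = 0 >]].

Fact hochschild_linear (c : k) f g :
  hochschild (c *: f + g) = c *: hochschild f + hochschild g.
Proof.
apply/funext => -[|a s] /=; rewrite !fctE /= ?scaler0 ?addr0 //.
rewrite mulrDr mulrDl -scalerAr -scalerAl !scalerDr scaler_sumr.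
rewrite !scalerA [_ * c]mulrC.
under eq_bigr => i _ do rewrite scalerDr scalerA [_ * c]mulrC -scalerA.
rewrite big_split /=.
by rewrite [RHS](AC (3*3) ((1*4)*(2*5)*(3*6))).
Qed.

Fact cochain0 : cochain (0 : seq A -> A).
Proof.
have E s : (0 : seq A -> A) s = 0 by [].
by split=> [s t c x y|]; [rewrite !E scaler0 addr0 | exists 0%N].
Qed.

Fact cochain_linear (c : k) f g : cochain f -> cochain g -> cochain (c *: f + g).
Proof.
move=> [lf [M fM]] [lg [N gN]]; split=> [s t b x y|].
  rewrite !fctE /= lf lg !scalerDr !scalerA [c * b]mulrC -!addrA.
  by congr (_ + _); rewrite addrCA.
exists (maxn M N) => s; rewrite geq_max => /andP[Ms Ns].
by rewrite !fctE /= fM // gN // scaler0 addr0.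
Qed.

Fact hochschild0 : hochschild 0 = 0.
Proof.
by have := hochschild_linear (-1) 0 0; rewrite scaler0 addr0 scaleN1r addNr.
Qed.

Fact cocycle_submod : submod_closed cocycle.
Proof.
split=> [|c f g /asboolP[cf df] /asboolP[cg dg]]; apply/asboolP; split.
- exact: cochain0.
- exact: hochschild0.
- exact: cochain_linear.
- by rewrite hochschild_linear df dg scaler0 addr0.
Qed.
HB.instance Definition _ :=
  GRing.isSubmodClosed.Build k (seq A -> A) cocycle cocycle_submod.

Definition Z_HH := {f : seq A -> A | cocycle f}.
HB.instance Definition _ := SubChoice.on Z_HH.
HB.instance Definition _ := [SubChoice_isSubLmodule of Z_HH by <:].

Definition coboundary : pred Z_HH :=
  [pred z | `[< exists2 g, cochain g & val z = hochschild g >]].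

Fact coboundary_submod : submod_closed coboundary.
Proof.
split=> [|c y z /asboolP[f cf yf] /asboolP[g cg zg]]; apply/asboolP.
  by exists 0; [exact: cochain0 | rewrite hochschild0 raddf0].
exists (c *: f + g); first exact: cochain_linear.
by rewrite hochschild_linear -yf -zg linearP.
Qed.
HB.instance Definition _ :=
  GRing.isSubmodClosed.Build k Z_HH coboundary coboundary_submod.

(* The total Hochschild cohomology, i.e. the direct sum of all HH^n(A, A) *)
Definition HH :=
  lmod_quot (GRing.SubmodClosed.clone k Z_HH coboundary _).
HB.instance Definition _ := GRing.Lmodule.on HH.
HB.instance Definition _ := Quotient.on HH.

(* f is a cocycle, and x is its cohomology class *)
Definition represents f (x : HH) :=
  exists2 z : Z_HH, val z = f & \pi_HH z = x.

Definition HH_deg (n : nat) (x : HH) :=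
  exists2 f, homogeneous n f & represents f x.

Definition induced_by_cup (mul : HH -> HH -> HH) :=
  forall f g x y,
    represents f x -> represents g y -> represents (cup f g) (mul x y).

(* The first clause is the comparison of the full and normalized complexes,   *)
(* without which the second one would not determine Delta.                    *)
Definition induced_by_BV_dual (eta : A -> A -> k) (Delta : HH -> HH) :=
  (forall x, exists2 f, normalized f & represents f x) /\
  (forall f x, normalized f -> represents f x ->
     exists2 g, BV_dual eta f g & normalized g /\ represents g (Delta x)).

End Cochains.

Section BVAlgebras.
Variables (k : fieldType) (H : lmodType k).
Variables (gr : nat -> H -> Prop) (mul : H -> H -> H) (Delta : H -> H).

Record is_grading : Prop := {
  gr0 : forall n, gr n 0;
  gr_linear : forall n (c : k) x y, gr n x -> gr n y -> gr n (c *: x + y);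
  gr_span : forall x, exists (N : nat) (y : nat -> H),
    (forall i, gr i (y i)) /\ x = \sum_(i < N) y i;
  gr_direct : forall (N : nat) (y : nat -> H), (forall i, gr i (y i)) ->
    \sum_(i < N) y i = 0 -> forall i, (i < N)%N -> y i = 0
}.

Record graded_comm_algebra : Prop := {
  gca_grading : is_grading;
  gca_linearl : forall y, linear (mul^~ y);
  gca_linearr : forall x, linear (mul x);
  gca_assoc : associative mul;
  gca_deg : forall m n x y, gr m x -> gr n y -> gr (m + n)%N (mul x y);
  gca_comm : forall m n x y, gr m x -> gr n y ->
    mul x y = (-1) ^+ (m * n) *: mul y x
}.

Record BV_algebra : Prop := {
  BV_gca : graded_comm_algebra;
  BV_linear : linear Delta;
  BV_deg0 : forall x, gr 0 x -> Delta x = 0;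
  BV_degS : forall n x, gr n.+1 x -> gr n (Delta x);
  BV_square : forall x, Delta (Delta x) = 0;
  BV_seven_term : forall m n p a b c, gr m a -> gr n b -> gr p c ->
    Delta (mul (mul a b) c) =
      mul (Delta (mul a b)) c
      + (-1) ^+ m *: mul a (Delta (mul b c))
      + (-1) ^+ (m.+1 * n) *: mul b (Delta (mul a c))
      - mul (mul (Delta a) b) c
      - (-1) ^+ m *: mul (mul a (Delta b)) c
      - (-1) ^+ (m + n) *: mul (mul a b) (Delta c)
}.

(* {a, b} for a of degree m *)
Definition BV_bracket (m : nat) (a b : H) : H :=
  (-1) ^+ m *: (Delta (mul a b) - mul (Delta a) b - (-1) ^+ m *: mul a (Delta b)).

End BVAlgebras.

(* Main.v *)
Require Import Defs.
From HB Require Import structures.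
From mathcomp Require Import all_boot all_algebra.
From mathcomp Require Import falgebra sesquilinear boolp functions.
From mathcomp Require Import ring zify.

(* With lam := eta(1, _), a trace on A, a cochain f amounts to the form lam   *)
(* (a0 * f (a1, ..., an)), and Delta to the signed sum of the cyclic          *)
(* rotations of (a0, ..., an); the latter anticommutes with the Hochschild    *)
(* differential on all cochains, normalized or not. In the rotations of the   *)
(* cup product f u g, a0 is an argument of f or, exchanging the roles of f    *)
(* and g, of g. When f and g are cocycles, the first part is cohomologous to  *)
(* a combination of g u Delta f and f o g: the homotopy inserts g into the    *)
(* rotations of f, on the right of a0. This gives the expression of the       *)
(* Gerstenhaber bracket as the deviation of Delta from a derivation. The      *)
(* seven-term identity then says that the bracket is a derivation of the cup  *)
(* product in one variable, which follows from the homotopy given by the      *)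
(* brace f{g, h}. Among these identities, only Delta^2 = 0 needs normalized   *)
(* cochains.                                                                  *)

Set Implicit Arguments.
Unset Strict Implicit.
Unset Printing Implicit Defensive.

Import GRing.Theory.
Local Open Scope ring_scope.

(** The sketch above rests on a few identities between cochains. The Leibniz rule [hochschild_cup]
    makes the cup product descend to cohomology, and [hochschild_insertion] says that for
    homogeneous cocycles f o g bounds the graded commutator of f and g, so the product is graded
    commutative. Non-degeneracy and finite dimension ([riesz_ex]) turn a form lam (a0 * ?), linear
    in a0, into a unique element of A; this defines Delta on cochains as [BV_op]. By
    [hochschild_BV_op] it descends to cohomology. On a normalized cochain its square is zero
    ([BV_op_BV_op]), and every class has a normalized representative ([normalized_ex]).

    The central formula is [BV_op_cup]: for homogeneous cocycles, Delta (f u g) is the bracket plus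
    the two terms of a derivation, up to an explicit coboundary. It is assembled from
    [lam_rotations_cup], which cuts the rotations of f u g into two halves, and
    [lam_cyclic_hochschild_homotopy], which evaluates each half. Together with the Poisson rule
    [deviation_mul], a consequence of [hochschild_brace] and [insertion_cup], it yields
    [seven_term].

    Words are handled by recursion rather than by indices: sums over positions become sums over cuts
    of a word ([splits]), and differentials are peeled off one letter at a time. *)

Lemma signP (R : pzRingType) (n : nat) :
  {(-1) ^+ n = 1 :> R} + {(-1) ^+ n = -1 :> R}.
Proof. by rewrite -signr_odd; case: (odd n); [right | left]. Qed.

(** * Linear forms separate points: reduction of identities in A to [ring] over k *)

Section Words.
Variables (k : fieldType) (A : falgType k).
Implicit Types (f g : seq A -> A) (F : seq A -> seq A -> A) (s t u v w : seq A).

(** The coordinates in a basis are linear forms. After applying an arbitrary form, an additive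
    identity in the noncommutative algebra A lives in the field k, where [ring] decides it; this is
    the tactic [lin]. *)
Lemma scalar_ext (x y : A) : (forall l : {scalar A}, l x = l y) -> x = y.
Proof.
move=> h; rewrite (coord_vbasis (memvf x)) (coord_vbasis (memvf y)).
apply: eq_bigr => i _.
by rewrite -![coord _ _ _]/((coord (vbasis {: A}) i : {scalar A}) _) h.
Qed.

Lemma scalarE (l : {scalar A}) :
  (forall x y, l (x + y) = l x + l y) * (forall c x, l (c *: x) = c * l x) *
  (forall x, l (- x) = - l x) * (l 0 = 0).
Proof.
by split; [split; [split=> *; [exact: raddfD | exact: linearZ]
  | exact: raddfN] | exact: raddf0].
Qed.

End Words.

Ltac expand_signs :=
  rewrite ?(mulSn, mulnS, mulnDl, mulnDr, muln0, mul0n);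
  rewrite ?(exprD, exprS, expr0); rewrite ?exprM.
Ltac lin := apply: scalar_ext => ?; rewrite ?scalarE; expand_signs.
(* The value chosen for a sign is kept as an equation, since the sign may     *)
(* reappear once an exponential tower ((-1) ^+ n) ^+ m gets simplified.       *)
Ltac sring :=
  expand_signs;
  repeat match goal with
  | H : @GRing.exp ?R (-1) ?n = _ |- context [@GRing.exp ?R (-1) ?n] =>
      rewrite H ?expr1n
  | |- context [@GRing.exp ?R (-1) ?n] =>
      let H := fresh "sgn" in case: (signP R n) => H; rewrite H ?expr1n
  end; ring.

(** * The Hochschild differential by recursion on words *)

Section Splits.
Variables (k : fieldType) (A : falgType k).
Implicit Types (f g : seq A -> A) (F G : seq A -> seq A -> A).
Implicit Types (s t u v w : seq A).

(** Deconcatenation of a word. The cup product is an instance, and the recursion [splits_cons]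
    replaces reindexing of sums by induction on the word. *)
Definition splits F s : A := \sum_(i < (size s).+1) F (take i s) (drop i s).

Lemma splits_nil F : splits F [::] = F [::] [::].
Proof. by rewrite /splits big_ord1. Qed.

Lemma splits_cons F a s :
  splits F (a :: s) = F [::] (a :: s) + splits (fun u => F (a :: u)) s.
Proof. by rewrite /splits big_ord_recl. Qed.

Lemma eq_splits F G s :
  (forall u v, size u + size v = size s -> F u v = G u v)%N -> splits F s =
    splits G s.
Proof.
move=> FG; apply: eq_bigr => i _; apply: FG.
by rewrite -size_cat cat_take_drop.
Qed.

Lemma splits0 s : splits (fun _ _ => 0) s = 0.
Proof. exact: big1. Qed.

Lemma splitsD F G s : splits (fun u v => F u v + G u v) s
  = splits F s + splits G s.
Proof. exact: big_split. Qed.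

Lemma splitsN F s : splits (fun u v => - F u v) s = - splits F s.
Proof. exact: sumrN. Qed.

Lemma splitsB F G s : splits (fun u v => F u v - G u v) s
  = splits F s - splits G s.
Proof. by rewrite splitsD splitsN. Qed.

Lemma splitsZ c F s : splits (fun u v => c *: F u v) s = c *: splits F s.
Proof. by rewrite /splits scaler_sumr. Qed.

Lemma splitsMl a F s : splits (fun u v => a * F u v) s = a * splits F s.
Proof. by rewrite /splits mulr_sumr. Qed.

Lemma splitsMr a F s : splits (fun u v => F u v * a) s = splits F s * a.
Proof. by rewrite /splits mulr_suml. Qed.

(** Coassociativity of deconcatenation: both sides sum over the ways to cut s into three pieces. *)
Lemma splits_assoc (F : seq A -> seq A -> seq A -> A) s :
  splits (fun t w => splits (fun u v => F u v w) t) s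
  = splits (fun u t => splits (fun v w => F u v w) t) s.
Proof.
elim: s F => [|a s IH] F; first by rewrite !splits_nil.
rewrite !splits_cons splits_nil -addrA; congr (_ + _).
by under eq_splits => u v _ do rewrite splits_cons; rewrite splitsD IH.
Qed.

(* A letter between the two parts of a split may be counted in either part. *)
Lemma splits_shift (F : seq A -> A -> seq A -> A) s :
  splits (fun u v => if v is x :: v' then F u x v' else 0) s
  = splits (fun u v => if u is x :: u' then F (belast x u') (last x u') v else
    0) s.
Proof.
elim: s F => [|a s IH] F; first by rewrite !splits_nil.
rewrite !splits_cons add0r IH.
case: s IH => [|b s] IH; first by rewrite !splits_nil addr0.
by rewrite !splits_cons add0r.
Qed.

Lemma splits_behead (F : A -> seq A -> seq A -> A) s :
  splits (fun u v => if u is x :: u' then F x u' v else 0) s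
  = if s is x :: s' then splits (F x) s' else 0.
Proof. by case: s => [|a s]; rewrite ?splits_nil // splits_cons add0r. Qed.

Lemma splits_nill (G : seq A -> A) s :
  splits (fun u v => if u is [::] then G v else 0) s = G s.
Proof.
by case: s => [|a s]; rewrite ?splits_nil // splits_cons splits0 addr0.
Qed.

Lemma splits_nilr (G : seq A -> A) s :
  splits (fun u v => if v is [::] then G u else 0) s = G s.
Proof.
elim: s G => [|a s IH] G; first by rewrite splits_nil.
by rewrite splits_cons add0r (IH (fun t => G (a :: t))).
Qed.

Lemma splits_last (F : seq A -> seq A -> A -> A) s :
  splits (fun u v => if v is x :: v' then F u (belast x v') (last x v') else 0)
    s
  = if s is x :: s' then splits (fun u v => F u v (last x s')) (belast x s')
    else 0.
Proof.
elim: s F => [|a s IH] F; first by rewrite splits_nil.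
rewrite splits_cons (IH (fun u => F (a :: u))).
case: s {IH} => [|b s]; first by rewrite splits_nil addr0.
by rewrite [in RHS]splits_cons.
Qed.

(* bar f is the part of hochschild f which multiplies two adjacent letters;   *)
(* rbar f also includes the right multiplication by the last letter. Being    *)
(* recursive on the word, they are handled by induction, with f generalized.  *)
Fixpoint bar f s : A :=
  if s is a :: s' then
    - (if s' is b :: t then f (a * b :: t) else 0) - bar (fun t => f (a :: t))
      s'
  else 0.

(** When no letter follows, [a] is merged into the output of f. This is how [rbar] absorbs the right
    multiplication without a separate case. *)
Definition lmerge f a s : A := if s is b :: t then f (a * b :: t) else f [::] *
  a.

Fixpoint rbar f s : A :=
  if s is a :: s' then - lmerge f a s' - rbar (fun t => f (a :: t)) s' else 0.

Definition lmul f s : A := if s is a :: s' then a * f s' else 0.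

Definition rmul f s : A :=
  if s is a :: s' then f (belast a s') * last a s' else 0.

Lemma rbarE f s : rbar f s = bar f s + (-1) ^+ size s *: rmul f s.
Proof.
elim: s f => [|a s IH] f /=; first by rewrite scaler0 addr0.
rewrite IH; case: s {IH} => [|b s] /=.
  by lin; ring.
by lin; ring.
Qed.

Lemma hochschildE f s : hochschild f s = lmul f s + rbar f s.
Proof.
case: s => [|a s] /=; first by rewrite addr0.
rewrite -addrA; congr (_ + _); rewrite -[RHS]/(rbar f (a :: s)).
rewrite rbarE; congr (_ + _).
elim: s a f => [|b s IH] a f /=; first by rewrite big_ord0 subr0 oppr0.
rewrite big_ord_recl /= expr1 scaleN1r drop0; congr (_ + _).
rewrite -[RHS]/(- bar (fun t => f (a :: t)) (b :: s)) -IH -sumrN.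
by apply: eq_bigr => i _; rewrite [in LHS]exprS mulN1r scaleNr.
Qed.

Lemma eq_bar f g s : f =1 g -> bar f s = bar g s.
Proof. by move=> /funext->. Qed.

Lemma eq_rbar f g s : f =1 g -> rbar f s = rbar g s.
Proof. by move=> /funext->. Qed.

Lemma lmergeD f g a s :
  lmerge (fun s => f s + g s) a s = lmerge f a s + lmerge g a s.
Proof. by case: s => [|b s] //=; rewrite mulrDl. Qed.

Lemma lmergeZ c f a s : lmerge (fun s => c *: f s) a s = c *: lmerge f a s.
Proof. by case: s => [|b s] //=; rewrite scalerAl. Qed.

Lemma barD f g s : bar (fun s => f s + g s) s = bar f s + bar g s.
Proof.
elim: s f g => [|a s IH] f g /=; first by rewrite addr0.
by rewrite IH; case: s {IH} => [|b s] /=; lin; ring.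
Qed.

Lemma rbarD f g s : rbar (fun s => f s + g s) s = rbar f s + rbar g s.
Proof.
elim: s f g => [|a s IH] f g /=; first by rewrite addr0.
by rewrite IH lmergeD; lin; ring.
Qed.

Lemma rbarZ c f s : rbar (fun s => c *: f s) s = c *: rbar f s.
Proof.
elim: s f => [|a s IH] f /=; first by rewrite scaler0.
by rewrite IH lmergeZ; lin; ring.
Qed.

Lemma rbarN f s : rbar (fun s => - f s) s = - rbar f s.
Proof.
by rewrite -scaleN1r -rbarZ; apply: eq_rbar => t; rewrite scaleN1r.
Qed.

Lemma rbarMl a f s : rbar (fun s => a * f s) s = a * rbar f s.
Proof.
elim: s f => [|b s IH] f /=; first by rewrite mulr0.
by rewrite IH mulrBr mulrN; case: s {IH} => [|c s] //=; rewrite mulrA.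
Qed.

Lemma bar_size (G : nat -> k) f s :
  bar (fun t => G (size t).+1 *: f t) s = G (size s) *: bar f s.
Proof.
elim: s G f => [|a s IH] G f /=; first by rewrite scaler0.
rewrite (IH (fun n => G n.+1)); case: s {IH} => [|b s] /=; last by lin; ring.
by rewrite subr0 oppr0 !scaler0 subr0.
Qed.

(** A cut of a word with a merged letter never falls inside that letter, so each merge takes place
    entirely in one of the two parts; the sign comes from passing over the first part. *)
Lemma bar_splits F s :
  bar (splits F) s
  = splits (fun u v => bar (F^~ v) u + (-1) ^+ size u *: bar (F u) v) s.
Proof.
elim: s F => [|a s IH] F; first by rewrite splits_nil scale1r /= addr0.
rewrite splits_cons /= add0r scale1r.
rewrite [X in _ = _ + X](_ : _ =
  - (if s is b :: t then splits (fun u => F (a * b :: u)) t else 0)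
  - bar (splits (fun u => F (a :: u))) s); last first.
  rewrite IH -(splits_behead (fun b t v => F (a * b :: t) v)) -!splitsN
    -splitsD.
  by apply: eq_splits => u v _; lin; ring.
rewrite (eq_bar _ (splits_cons F a)) barD.
by case: s {IH} => [|b s] /=; rewrite ?splits_cons; lin; ring.
Qed.

Lemma rbar_splits F s :
  rbar (splits F) s
  = splits (fun u v => bar (F^~ v) u + (-1) ^+ size u *: rbar (F u) v) s.
Proof.
elim: s F => [|a s IH] F; first by rewrite splits_nil scale1r /= addr0.
rewrite splits_cons /= add0r scale1r.
rewrite [X in _ = _ + X](_ : _ =
  - (if s is b :: t then splits (fun u => F (a * b :: u)) t else 0)
  - rbar (splits (fun u => F (a :: u))) s); last first.
  rewrite IH -(splits_behead (fun b t v => F (a * b :: t) v)) -!splitsN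
    -splitsD.
  by apply: eq_splits => u v _; lin; ring.
rewrite (eq_rbar _ (splits_cons F a)) rbarD.
by case: s {IH} => [|b s] /=; rewrite ?splits_nil ?splits_cons; lin; ring.
Qed.

Lemma rbar_lmerge f a s : rbar (lmerge f a) s = lmerge (rbar f) a s.
Proof.
case: s => [|b s] /=; first by rewrite mul0r.
by congr (- _ - _); case: s => [|c s] /=; rewrite mulrA.
Qed.

(** By induction on the word: since [rbar] commutes with [lmerge], the two mixed terms cancel, and
    no double sum over positions appears. *)
Lemma rbarK f s : rbar (rbar f) s = 0.
Proof.
elim: s f => [|a s IH] f //=.
rewrite rbarD !rbarN (IH (fun t => f (a :: t))) rbar_lmerge.
by rewrite oppr0 addr0 opprK addNr.
Qed.

Lemma rbar_lmul f s : rbar (lmul f) s = - lmul (hochschild f) s.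
Proof.
case: s => [|a s] /=; first by rewrite oppr0.
rewrite rbarMl hochschildE mulrDr opprD; congr (- _ - _).
by case: s => [|b s] /=; rewrite ?mul0r ?mulr0 // mulrA.
Qed.

Lemma hochschild_hochschild f s : hochschild (hochschild f) s = 0.
Proof.
rewrite hochschildE (eq_rbar _ (hochschildE f)) rbarD rbarK addr0.
by rewrite rbar_lmul addrN.
Qed.

Lemma barMr a f s : bar (fun s => f s * a) s = bar f s * a.
Proof.
elim: s f => [|b s IH] f /=; first by rewrite mul0r.
by rewrite IH mulrBl mulNr; case: s {IH} => [|c s] //=; rewrite mul0r.
Qed.

Lemma hochschild_cup f g s :
  hochschild (cup f g) s = cup (hochschild f) g s
  + cup (fun t => (-1) ^+ size t *: f t) (hochschild g) s.
Proof.
rewrite hochschildE -[cup f g]/(splits (fun u v => f u * g v)) rbar_splits.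
rewrite -[cup _ g s]/(splits (fun u v => hochschild f u * g v) s).
rewrite -[cup _ _ s]/(splits (fun u v => (-1) ^+ size u *: f u * hochschild g
  v) s).
(* [X] and [Y] are the two readings of f(u) x g(v): x is the last letter given to df, or the first
   letter given to dg. Moving x across the cut ([splits_shift]) shows that they cancel. *)
pose X := splits (fun u v => (-1) ^+ size u *: (rmul f u * g v)) s.
pose Y := splits (fun u v => (-1) ^+ size u *: (f u * lmul g v)) s.
have XY : X + Y = 0.
  rewrite /Y (eq_splits (G := fun u v => if v is x :: v' then
    (-1) ^+ size u *: (f u * (x * g v')) else 0)); last first.
    by move=> u [|x v] //= _; rewrite mulr0 scaler0.
  rewrite (splits_shift (fun u x v' => (-1) ^+ size u *: (f u * (x * g v'))))
    -splitsD.
  rewrite -[RHS](splits0 s); apply: eq_splits => -[|x u] v _ /=.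
    by rewrite mul0r scaler0 add0r.
  by rewrite size_belast mulrA; lin; ring.
transitivity (splits (fun u v => lmul f u * g v + bar f u * g v
  + (-1) ^+ size u *: (f u * rbar g v)) s + (X + Y)).
  rewrite XY addr0 !splitsD -addrA; congr (_ + _); last first.
    by congr (_ + _); apply: eq_splits => u v _; rewrite ?barMr ?rbarMl.
  rewrite (eq_splits (G := fun u v => if u is x :: u' then x * (f u' * g v)
    else 0)).
    by rewrite splits_behead; case: s {X Y XY} => [|x s] //=; rewrite splitsMl.
  by move=> [|x u] v _ /=; rewrite ?mul0r ?mulrA.
rewrite -!splitsD; apply: eq_splits => u v _; rewrite !hochschildE (rbarE f).
by rewrite !mulrDl mulrDr -!scalerAl; lin; ring.
Qed.
End Splits.

(** * Insertions and braces *)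

Section Insertions.
Variables (k : fieldType) (A : falgType k).
Implicit Types (f g F G : seq A -> A) (s t u v w : seq A) (m n p : nat).

Lemma multilinear_cons F a : multilinear F -> multilinear (fun t => F (a :: t)).
Proof. by move=> lF s t c x y; rewrite -!cat_cons lF. Qed.

Section Head.
Variables (F : seq A -> A) (lF : multilinear F).

Lemma headD x y t : F ((x + y) :: t) = F (x :: t) + F (y :: t).
Proof. by have := lF [::] t 1 x y; rewrite !scale1r. Qed.

Lemma head0 t : F (0 :: t) = 0.
Proof. by apply: (addrI (F (0 :: t))); rewrite -headD !addr0. Qed.

Lemma headZ c x t : F (c *: x :: t) = c *: F (x :: t).
Proof. by have := lF [::] t c x 0; rewrite addr0 /= head0 addr0. Qed.

Lemma headN x t : F (- x :: t) = - F (x :: t).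
Proof. by rewrite -scaleN1r headZ scaleN1r. Qed.

End Head.

(** Used to trade a sign depending on [size w] for one depending on n: where the lengths differ, the
    term vanishes. *)
Lemma homogeneousP n g w : homogeneous n g -> (size w == n) || (g w == 0).
Proof. by move=> hg; case: eqVneq => //= /hg->. Qed.

Definition insert_head g F s : A := splits (fun w v => F (g w :: v)) s.

(* The recursive form of circ n F g, see circE. *)
Fixpoint insertion n F g s : A :=
  insert_head g F s
  + if s is a :: s' then (-1) ^+ n.+1 *: insertion n (fun t => F (a :: t)) g s'
    else 0.

(** The cup product with a Koszul sign read off the word; for F homogeneous of degree m it is
    (-1)^(mp) times [cup F g]. *)
Definition twisted_cup p F g s : A :=
  splits (fun u w => (-1) ^+ (size u * p) *: (F u * g w)) s.

Lemma twisted_cup_cons p F g a s :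
  twisted_cup p F g (a :: s)
  = F [::] * g (a :: s) + (-1) ^+ p *: twisted_cup p (fun t => F (a :: t)) g s.
Proof.
rewrite /twisted_cup splits_cons mul0n scale1r -splitsZ; congr (_ + _).
by apply: eq_splits => u v _; rewrite scalerA -exprD /= mulSn.
Qed.

Lemma insert_headD g F G s : insert_head g (fun t => F t + G t) s
  = insert_head g F s + insert_head g G s.
Proof. exact: splitsD. Qed.

Lemma insert_headZ g c F s : insert_head g (fun t => c *: F t) s
  = c *: insert_head g F s.
Proof. exact: splitsZ. Qed.

Lemma eq_insert_head g F G s : (forall x t, F (x :: t) = G (x :: t)) ->
  insert_head g F s = insert_head g G s.
Proof. by move=> FG; apply: eq_splits => u v _. Qed.

Lemma eq_insertion n F G g s : (forall x t, F (x :: t) = G (x :: t)) ->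
  insertion n F g s = insertion n G g s.
Proof.
elim: s F G => [|a s IH] F G FG /=; rewrite (eq_insert_head _ _ FG) //.
by rewrite (IH (fun t => F (a :: t)) (fun t => G (a :: t))).
Qed.

Lemma insertionD n F G g s : insertion n (fun t => F t + G t) g s
  = insertion n F g s + insertion n G g s.
Proof.
elim: s F G => [|a s IH] F G /=; rewrite insert_headD ?addr0 //.
by rewrite IH; lin; ring.
Qed.

Lemma insertionZ n c F g s : insertion n (fun t => c *: F t) g s
  = c *: insertion n F g s.
Proof.
elim: s F => [|a s IH] F /=; rewrite insert_headZ ?addr0 //.
by rewrite IH; lin; ring.
Qed.

Lemma insertion_vanish n F g s : (forall x t, F (x :: t)
  = 0) -> insertion n F g s = 0.
Proof.
move=> F0; rewrite -[RHS](scale0r (insertion n F g s)) -insertionZ;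
  apply: eq_insertion => x t.
by rewrite F0 scale0r.
Qed.

Lemma insertionN n F g s : insertion n (fun t => - F t) g s
  = - insertion n F g s.
Proof.
by rewrite -scaleN1r -insertionZ; apply: eq_insertion => x t; rewrite scaleN1r.
Qed.

Lemma insertion_lmerge n F a g s :
  insertion n (lmerge F a) g s = splits (fun w v => F (a * g w :: v)) s
  + if s is b :: t then (-1) ^+ n.+1 *: insertion n (fun t => F (a * b :: t)) g
    t else 0.
Proof. by case: s. Qed.

(** In dg, the right multiplication of g(w) by the last letter becomes, once that letter is moved
    across the cut, the merge of g(w) with the letter behind it, which is a term of [rbar F]. When
    no letter is left behind g(w), [rbar F] contributes F [::] * g s instead, whence the last
    term. *)
Lemma rbar_insert_head n F g s : multilinear F -> homogeneous n g ->
  rbar (insert_head g F) s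
  = insert_head (hochschild g) F s - splits (fun w v => F (lmul g w :: v)) s
    - (-1) ^+ n *: insert_head g (rbar F) s - (-1) ^+ n *: (F [::] * g s).
Proof.
move=> lF hg; rewrite /insert_head rbar_splits.
(* [P] merges the value of g with the next letter. *)
pose P w v := if v is x :: v' then F (g w * x :: v') else 0.
rewrite -(splits_nilr (fun u => F [::] * g u)) -!splitsZ.
have -> : splits (fun w v => F (hochschild g w :: v)) s
  = splits (fun w v => F (lmul g w :: v) + F (bar g w :: v)
         - (-1) ^+ n *: F (rmul g w :: v)) s.
  apply: eq_splits => w v _; rewrite hochschildE rbarE !(headD lF) addrA (headZ
    lF).
  congr (_ + _); rewrite -scaleNr; case: w => [|x w] /=.
    by rewrite (head0 lF) !scaler0.
  have := homogeneousP (belast x w) hg; rewrite size_belast =>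
    /orP[/eqP->|/eqP->].
    by rewrite exprS mulN1r.
  by rewrite mul0r (head0 lF) !scaler0.
have -> : splits (fun w v => F (lmul g w :: v) + F (bar g w :: v)
            - (-1) ^+ n *: F (rmul g w :: v)) s
  = splits (fun w v => F (lmul g w :: v) + F (bar g w :: v)
            - (-1) ^+ n *: P w v) s.
  rewrite !splitsB; congr (_ - _); rewrite !splitsZ; congr (_ *: _).
  rewrite (splits_shift (fun w x v' => F (g w * x :: v'))).
  by apply: eq_splits => -[|x w] v _ //=; rewrite (head0 lF).
rewrite -!splitsB; apply: eq_splits => w v _.
have -> : bar (fun w => F (g w :: v)) w = F (bar g w :: v).
  elim: w (g) => [|a w IH] h /=; first by rewrite (head0 lF).
  rewrite IH (headD lF) !(headN lF); congr (- _ - _).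
  by case: w {IH} => //=; rewrite (head0 lF).
have -> : (-1) ^+ size w *: rbar (fun t => F (g w :: t)) v
        = (-1) ^+ n *: rbar (fun t => F (g w :: t)) v.
  have /orP[/eqP->//|/eqP->] := homogeneousP w hg.
  rewrite (@eq_rbar _ _ _ (fun t => 0 *: F t)) ?rbarZ ?scale0r ?scaler0 //.
  by move=> t; rewrite (head0 lF) scale0r.
by case: v => [|x v] /=; lin; ring.
Qed.

(** The left multiplications inside g, left over by [rbar_insert_head], cancel against the terms of
    [rbar F] which merge a letter with the value of g inserted behind it ([insertion_lmerge]). *)
Lemma rbar_insertion n F g s : multilinear F -> homogeneous n g ->
  rbar (insertion n F g) s
  = insertion n.+1 F (hochschild g) s - (-1) ^+ n *: insertion n (rbar F) g s
    - (-1) ^+ n *: twisted_cup n F g s.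
Proof.
move=> + hg; elim: s F => [|a s IH] F lF.
  rewrite /= /insert_head !splits_nil (head0 lF) /twisted_cup splits_nil mul0n
    /= addr0.
  by lin; ring.
rewrite [LHS]/= rbarD rbarZ IH; last exact: multilinear_cons.
rewrite twisted_cup_cons [insertion n.+1 _ _ _]/= [insertion n (rbar F) _ _]/=.
have /= := @rbar_insert_head n F g (a :: s) lF hg.
have -> : splits (fun w v => F (lmul g w :: v)) (a :: s)
   = splits (fun w v => F (a * g w :: v)) s.
  by rewrite splits_cons /= (head0 lF) add0r.
have -> : insertion n (fun t => - lmerge F a t - rbar (fun t0 => F (a :: t0))
  t) g s
  = - insertion n (lmerge F a) g s - insertion n (rbar (fun t0 => F (a :: t0)))
    g s.
  by rewrite insertionD !insertionN.
rewrite insertion_lmerge.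
set I := insert_head g F; set J := rbar (fun t => insert_head _ _ _) s.
move=> H.
(* [J] is completed to the value of [rbar] on the whole word [a :: s], which [H] computes. *)
have -> : J = - (- lmerge I a s - J) - lmerge I a s by lin; ring.
rewrite {}H.
rewrite /I; case: s {IH J} => [|b s] /=; last by lin; sring.
by rewrite addr0; lin; sring.
Qed.

(** An insertion of g at the head of a * f(s) fills the left factor, which gives g u f; this is the
    second cup product in the coboundary of f o g. *)
Lemma lmulE_insertion n f g s :
  insertion n (lmul f) g s = cup g f s + (-1) ^+ n.+1 *: lmul (insertion n f g)
    s.
Proof.
case: s => [|a s] /=; first by rewrite scaler0.
congr (_ + _ *: _); elim: s f => [|b s IH] f /=.
  by rewrite /insert_head !splits_nil !addr0.
rewrite /insert_head splitsMl mulrDr; congr (_ + _).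
by rewrite (IH (fun t => f (b :: t))) scalerAr.
Qed.

Lemma insert_headE n F g s : multilinear F -> homogeneous n g ->
  insert_head g F s
  = if (n <= size s)%N then F (g (take n s) :: drop n s) else 0.
Proof.
move=> lF hg.
have g0 i : (i <= size s)%N -> i != n -> F (g (take i s) :: drop i s) = 0.
  by move=> si ni; rewrite hg ?(head0 lF) // size_takel.
case: leqP => [ns | sn].
  rewrite /insert_head /splits (bigD1 (Ordinal (ns : n < (size s).+1)%N)) //=.
  rewrite big1 ?addr0 // => i; rewrite -val_eqE /= => ni.
  by rewrite g0 // -ltnS.
rewrite /insert_head /splits big1 // => i _; rewrite g0 // -1?ltnS //.
by rewrite neq_ltn (leq_trans (ltn_ord i)).
Qed.

(** Among all prefixes on which [insertion] evaluates g, homogeneity keeps the one of length n; the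
    others put a 0 into F. *)
Lemma circE n F g s : multilinear F -> homogeneous n g ->
  circ n F g s = insertion n F g s.
Proof.
move=> + hg; elim: s F => [|a s IH] F lF; rewrite /= (insert_headE _ lF hg)
  /circ.
  rewrite big_mkcond big_ord1 add0n mul0n scale1r /= addr0.
  by case: n {hg} => [|n] //=; rewrite drop0.
rewrite big_mkcond big_ord_recl /= add0n mul0n scale1r ?drop0.
congr (_ + _); rewrite -(IH _ (multilinear_cons _ lF)) /circ [in RHS]big_mkcond.
rewrite scaler_sumr; apply: eq_bigr => i _ /=.
rewrite /bump /= add1n addSn ltnS; case: leqP => _; last by rewrite scaler0.
by rewrite mulSn exprD scalerA.
Qed.

Lemma insertion0 n F g s : multilinear F -> (forall w, g w
  = 0) -> insertion n F g s = 0.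
Proof.
move=> + g0; elim: s F => [|a s IH] F lF /=.
  by rewrite /insert_head splits_nil g0 (head0 lF) addr0.
rewrite (IH _ (multilinear_cons _ lF)) scaler0 addr0 /insert_head
  -[RHS](splits0 (a :: s)).
by apply: eq_splits => u v _; rewrite g0 (head0 lF).
Qed.

Lemma insertionMl n a F g s : insertion n (fun t => a * F t) g s
  = a * insertion n F g s.
Proof.
elim: s F => [|b s IH] F /=; rewrite /insert_head splitsMl ?addr0 //.
by rewrite (IH (fun t => F (b :: t))) mulrDr scalerAr.
Qed.

Lemma head_splits F (G : seq A -> seq A -> A) s t : multilinear F ->
  F (splits G s :: t) = splits (fun u v => F (G u v :: t)) s.
Proof.
move=> lF; elim: s G => [|a s IH] G; first by rewrite !splits_nil.
by rewrite !splits_cons (headD lF) IH.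
Qed.

Lemma cupE f g s : cup f g s = splits (fun u v => f u * g v) s.
Proof. by []. Qed.

Lemma cup_nil f g : cup f g [::] = f [::] * g [::].
Proof. by rewrite cupE splits_nil. Qed.

Lemma cup_cons f g a s :
  cup f g (a :: s) = f [::] * g (a :: s) + cup (fun t => f (a :: t)) g s.
Proof. by rewrite cupE splits_cons. Qed.

Lemma cupDl f1 f2 g s :
  cup (fun t => f1 t + f2 t) g s = cup f1 g s + cup f2 g s.
Proof. by rewrite !cupE -splitsD; apply: eq_splits => u v _;
  rewrite mulrDl. Qed.

Lemma cupZl c f g s : cup (fun t => c *: f t) g s = c *: cup f g s.
Proof. by rewrite !cupE -splitsZ; apply: eq_splits => u v _;
  rewrite scalerAl. Qed.

Lemma insert_head_cup f g h s :
  insert_head h (cup f g) s = f [::] * insert_head h g s + cup (insert_head h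
    f) g s.
Proof.
rewrite /insert_head -splitsMl cupE.
rewrite [X in _ = _ + X](_ : _
  = splits (fun t w => splits (fun u v => f (h u :: v) * g w) t) s); last first.
  by apply: eq_splits => u v _; rewrite splitsMr.
rewrite splits_assoc -splitsD; apply: eq_splits => w v _.
by rewrite cup_cons cupE.
Qed.

(** h is inserted into an argument of f or of g: insertion into a cup product is a derivation on the
    nose, whereas insertion of a cup product is one only up to the homotopy [brace]. *)
Lemma insertion_cup n f g h s :
  insertion n (cup f g) h s = cup (insertion n f h) g s
  + splits (fun u v => (-1) ^+ (size u * n.+1) *: (f u * insertion n g h v)) s.
Proof.
elim: s f g => [|a s IH] f g.
  by rewrite /= insert_head_cup !cup_nil splits_nil mul0n scale1r /= !addr0
    addrC.
rewrite [LHS]/= insert_head_cup splits_cons mul0n scale1r !cup_cons.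
rewrite (cupDl (fun t => insert_head h f (a :: t))) cupZl.
rewrite (eq_insertion _ _ _ (G := fun t => f [::] * g (a :: t) +
  cup (fun t => f (a :: t)) g t)); last by move=> x t; rewrite cup_cons.
rewrite insertionD (insertionMl _ _ (fun t => g (a :: t))) IH.
rewrite [X in _ = _ + (_ + X)](_ : _ =
  (-1) ^+ n.+1 *: splits (fun u v => (-1) ^+ (size u * n.+1) *:
    (f (a :: u) * insertion n g h v)) s); last first.
  by rewrite -splitsZ; apply: eq_splits => u v _; rewrite scalerA -exprD -mulSn.
rewrite /= addr0 mulrDr -scalerAr.
by lin; ring.
Qed.

End Insertions.

Section Braces.
Variables (k : fieldType) (A : falgType k).
Implicit Types (f g h F G : seq A -> A) (s t u v w : seq A) (m n p : nat).

Definition insert_head2 p F g h s : A :=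
  splits (fun w v => insertion p (fun t => F (g w :: t)) h v) s.

(* Gerstenhaber's brace F{g, h}: all insertions of g and h into F, with g to  *)
(* the left of h. Its coboundary, for cocycles, is the defect of F o _ from   *)
(* being a derivation of the cup product, see hochschild_brace.               *)
Fixpoint brace n p F g h s : A :=
  insert_head2 p F g h s
  + if s is a :: s' then
      (-1) ^+ (n + p) *: brace n p (fun t => F (a :: t)) g h s'
    else 0.

Lemma insert_head2D p F G g h s :
  insert_head2 p (fun t => F t + G t) g h s = insert_head2 p F g h s +
    insert_head2 p G g h s.
Proof. by rewrite -splitsD; apply: eq_splits => u v _; rewrite insertionD. Qed.

Lemma insert_head2N p F g h s : insert_head2 p (fun t => - F t) g h s
  = - insert_head2 p F g h s.
Proof. by rewrite -splitsN; apply: eq_splits => u v _; rewrite insertionN. Qed.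

Lemma braceD n p F G g h s :
  brace n p (fun t => F t + G t) g h s = brace n p F g h s + brace n p G g h s.
Proof.
by elim: s F G => [|a s IH] F G /=; rewrite insert_head2D ?IH; lin; ring.
Qed.

Lemma braceN n p F g h s : brace n p (fun t => - F t) g h s
  = - brace n p F g h s.
Proof. by elim: s F => [|a s IH] F /=; rewrite insert_head2N ?IH; lin;
  ring. Qed.

Lemma eq_brace n p F G g h s : F =1 G -> brace n p F g h s = brace n p G g h s.
Proof. by move=> /funext->. Qed.

Lemma brace_lmerge n p F a g h s :
  brace n p (lmerge F a) g h s
  = splits (fun w v => insertion p (fun t => F (a * g w :: t)) h v) s
  + if s is b :: t then (-1) ^+ (n + p) *: brace n p (fun t => F (a * b :: t))
    g h t
    else 0.
Proof. by case: s. Qed.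

Lemma twisted_cupD p F G g s :
  twisted_cup p (fun t => F t + G t) g s = twisted_cup p F g s + twisted_cup p
    G g s.
Proof.
rewrite /twisted_cup -splitsD; apply: eq_splits => u v _.
by rewrite mulrDl scalerDr.
Qed.

Lemma twisted_cupZ p c F g s : twisted_cup p (fun t => c *: F t) g s
  = c *: twisted_cup p F g s.
Proof.
rewrite /twisted_cup -splitsZ; apply: eq_splits => u v _.
by rewrite -scalerAl !scalerA mulrC.
Qed.

Lemma insertion_cons0 n F g s : multilinear F -> insertion n (fun t => F (0 ::
  t)) g s = 0.
Proof.
by move=> lF; apply: insertion_vanish => x t; exact: head0.
Qed.

Lemma bar_insertion_cons p F g h v w : multilinear F ->
  bar (fun w => insertion p (fun t => F (g w :: t)) h v) w
  = insertion p (fun t => F (bar g w :: t)) h v.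
Proof.
move=> lF; elim: w g => [|a w IH] g /=; first by rewrite insertion_cons0.
rewrite (IH (fun w => g (a :: w))).
rewrite [RHS](eq_insertion _ _ _ (G := fun t =>
  - F ((if w is b :: t' then g (a * b :: t') else 0) :: t)
  + - F (bar (fun w => g (a :: w)) w :: t))); last first.
  by move=> x t; rewrite (headD lF) !(headN lF).
by rewrite insertionD !insertionN; case: w {IH} => //; rewrite insertion_cons0.
Qed.

Section Cocycles.
Variables (n p : nat) (g h : seq A -> A).
Hypotheses (hg : homogeneous n g) (hh : homogeneous p h).
Hypotheses (dg : forall s, hochschild g s = 0) (dh : forall s,
  hochschild h s = 0).

(** The analogue of [rbar_insert_head]. The new phenomenon is that [rbar F] may merge the value of g
    with that of h directly behind it, which produces the insertion of [cup g h]. *)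
Lemma rbar_insert_head2 F s : multilinear F ->
  rbar (insert_head2 p F g h) s
  = (-1) ^+ (n + p) *: (insert_head2 p (rbar F) g h s + insert_head (cup g h) F
    s
                        - (-1) ^+ (p * n) *: twisted_cup p (insert_head g F) h
                          s)
    - splits (fun w v => insertion p (fun t => F (lmul g w :: t)) h v) s.
Proof.
move=> lF; rewrite /insert_head2 rbar_splits.
pose L w t := F (g w :: t).
have mL w : multilinear (L w) by exact: multilinear_cons.
pose P w v := if v is x :: v' then insertion p (fun t => F (g w * x :: t)) h v'
  else 0.
pose Q w v := splits (fun w' z => F (g w * h w' :: z)) v.
transitivity (splits (fun w v => - insertion p (fun t => F (lmul g w :: t)) h v
  + (-1) ^+ n *: P w v
  - (-1) ^+ (n + p) *: insertion p (rbar (L w)) h v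
  - (-1) ^+ (n + p) *: twisted_cup p (L w) h v) s).
  pose R w v := (-1) ^+ n *: insertion p (fun t => F (rmul g w :: t)) h v.
  transitivity (splits (fun w v => - insertion p (fun t => F (lmul g w :: t)) h
    v + R w v
  - (-1) ^+ (n + p) *: insertion p (rbar (L w)) h v
  - (-1) ^+ (n + p) *: twisted_cup p (L w) h v) s).
    apply: eq_splits => w v _; rewrite bar_insertion_cons // -!addrA addrA;
      congr (_ + _).
      (* The cocycle condition for g, solved for the inner merges. The term [rmul] evaluates g on a
         word one letter shorter than w, so its sign (-1)^(size w) is (-1)^(n+1) wherever it does
         not vanish. *)
      have : bar g w = - lmul g w + (-1) ^+ n *: rmul g w.
        have := dg w; rewrite hochschildE rbarE => /eqP.
        rewrite addrA addr_eq0 => /eqP E.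
        apply: (addrI (lmul g w)); rewrite E addrA addrN add0r -scaleNr.
        case: (w) => [|x u] /=; first by rewrite !scaler0.
        have := homogeneousP (belast x u) hg.
        rewrite size_belast => /orP[/eqP->|/eqP->].
          by rewrite exprS mulN1r opprK.
        by rewrite mul0r !scaler0.
      move=> E; rewrite E /R -insertionZ -insertionN -insertionD;
        apply: eq_insertion => x t.
      by rewrite (headD lF) (headN lF) (headZ lF).
    rewrite (rbar_insertion v (mL w) hh) insertion0 // sub0r.
    have /orP[/eqP->|/eqP gw0] := homogeneousP w hg; first by lin; ring.
    have L0 t : L w t = 0 *: F t by rewrite /L gw0 (head0 lF) scale0r.
    rewrite (funext L0) twisted_cupZ (eq_insertion _ _ _ (G := fun t => 0 *:
      rbar F t)).
      by rewrite insertionZ !scale0r; lin; ring.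
    by move=> x t; rewrite rbarZ.
  rewrite !splitsB !splitsD; congr (_ + _ - _ - _).
  rewrite !splitsZ; congr (_ *: _).
  rewrite (splits_shift (fun w x v' => insertion p (fun t => F (g w * x :: t))
    h v')).
  by apply: eq_splits => -[|x w] v _ //=; rewrite insertion_cons0.
have -> : splits (fun w v => insertion p (fun t => rbar F (g w :: t)) h v) s
  = splits (fun w v => - Q w v - (-1) ^+ p.+1 *: P w v - insertion p (rbar (L
    w)) h v) s.
  apply: eq_splits => w v _.
  rewrite -[LHS]/(insertion p (fun t => - lmerge F (g w) t + - rbar (L w) t) h
    v).
  rewrite insertionD !insertionN; congr (_ - _); rewrite insertion_lmerge opprD.
  by congr (_ - _); case: v => //=; rewrite scaler0.
have -> : insert_head (cup g h) F s = splits Q s.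
  rewrite /insert_head -splits_assoc; apply: eq_splits => u v _.
  by rewrite cupE (head_splits _ _ _ lF).
have -> : twisted_cup p (insert_head g F) h s
    = (-1) ^+ (n * p) *: splits (fun w v => twisted_cup p (L w) h v) s.
  rewrite -splitsZ /twisted_cup.
  rewrite [LHS](eq_splits (G := fun t w' => splits (fun u v =>
     (-1) ^+ (n * p) *: ((-1) ^+ (size v * p) *: (L u v * h w'))) t)).
    by rewrite splits_assoc; apply: eq_splits => u v _; rewrite splitsZ.
  move=> t w' _; rewrite /insert_head -splitsMr -splitsZ;
    apply: eq_splits => u v uv.
  rewrite scalerA -exprD -mulnDl.
  have /orP[/eqP <-|/eqP gu0] := homogeneousP u hg; first by rewrite uv.
  by rewrite /L gu0 (head0 lF) mul0r !scaler0.
rewrite !splitsB !splitsD !splitsN !splitsZ mulnC.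
by lin; sring.
Qed.

Lemma rbar_brace F s : multilinear F ->
  rbar (brace n p F g h) s
  = (-1) ^+ (n + p) *: (brace n p (rbar F) g h s + insertion (n + p) F (cup g
    h) s
                        - (-1) ^+ (p * n) *: twisted_cup p (insertion n F g) h
                          s).
Proof.
elim: s F => [|a s IH] F lF.
  have := rbar_insert_head2 [::] lF; rewrite /= splits_nil insertion_cons0 //
    subr0 => H.
  by rewrite [LHS]H /twisted_cup !splits_nil /= !addr0.
rewrite [LHS]/= rbarD rbarZ IH; last exact: multilinear_cons.
have /= := rbar_insert_head2 (a :: s) lF.
rewrite (splits_cons (fun w => insertion p (fun t => F (lmul g w :: t)) h)).
rewrite [lmul g [::]]/= insertion_cons0 // add0r /=.
set I := insert_head2 p F g h; set J := rbar (fun t => insert_head2 _ _ _ _ (_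
  :: t)) s.
move=> H.
have -> : J = - (- lmerge I a s - J) - lmerge I a s by lin; ring.
rewrite {}H !twisted_cup_cons /=.
rewrite [brace n p (fun t => - lmerge F a t - _) g h s](_ : _ =
  - brace n p (lmerge F a) g h s - brace n p (rbar (fun t => F (a :: t))) g h
    s);
  last by rewrite braceD !braceN.
rewrite brace_lmerge twisted_cupD twisted_cupZ /I.
by case: s {IH J} => [|b s] /=; rewrite ?addr0; lin; sring.
Qed.

Lemma brace_lmul f s :
  brace n p (lmul f) g h s
  = cup g (insertion p f h) s + (-1) ^+ (n + p) *: lmul (brace n p f g h) s.
Proof.
have E F t : insert_head2 p (lmul F) g h t = cup g (insertion p F h) t.
  by rewrite cupE; apply: eq_splits => w v _; rewrite -insertionMl.
case: s => [|a s]; first by rewrite /= E scaler0.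
rewrite [LHS]/= E; congr (_ + _ *: _).
elim: s f => [|b s IH] f /=; rewrite /insert_head2.
  by rewrite !splits_nil !addr0 -insertionMl.
rewrite (IH (fun t => f (b :: t))) mulrDr -scalerAr; congr (_ + _).
by rewrite -splitsMl; apply: eq_splits => w v _; rewrite -insertionMl.
Qed.

(** For a cocycle f, [rbar f] equals [- lmul f], and a brace of [lmul f] with g at the head splits
    off g u (f o h) by [brace_lmul]. *)
Lemma hochschild_brace f s : multilinear f -> (forall s, hochschild f s = 0) ->
  hochschild (brace n p f g h) s
  = (-1) ^+ (n + p) *: (insertion (n + p) f (cup g h) s - cup g (insertion p f
    h) s
                        - (-1) ^+ (p * n) *: twisted_cup p (insertion n f g) h
                          s).
Proof.
move=> lf df; rewrite hochschildE rbar_brace //.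
rewrite (eq_brace _ _ _ _ _ (G := fun t => - lmul f t)) ?braceN ?brace_lmul.
  by lin; sring.
by move=> t; have := df t; rewrite hochschildE addrC => /eqP;
  rewrite addr_eq0 => /eqP.
Qed.

(** Gerstenhaber's homotopy for the graded commutativity of the cup product. *)
Lemma hochschild_insertion f s : multilinear f -> (forall s, hochschild f s
  = 0) ->
  hochschild (insertion n f g) s
  = (-1) ^+ n *: (cup g f s - twisted_cup n f g s).
Proof.
move=> lf df; rewrite hochschildE rbar_insertion // insertion0 //.
rewrite (eq_insertion _ _ _ (G := fun t => - lmul f t)) ?insertionN
  ?lmulE_insertion.
  by lin; sring.
move=> x t; have := df (x :: t); rewrite hochschildE addrC => /eqP.
by rewrite addr_eq0 => /eqP.
Qed.
End Cocycles.
End Braces.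

(** * Cyclic rotations *)

Section Cyclic.
Variables (k : fieldType) (A : falgType k) (lam : {scalar A}).
Hypothesis lamC : forall x y : A, lam (x * y) = lam (y * x).
Implicit Types (f g F : seq A -> A) (K : A -> seq A -> A).
Implicit Types (a : A) (s t u v w : seq A) (m n : nat).

Lemma eq_lam_splits (F G : seq A -> seq A -> A) s :
  (forall u v, size u + size v = size s -> lam (F u v) = lam (G u v))%N ->
  lam (splits F s) = lam (splits G s).
Proof.
move=> FG; rewrite !raddf_sum; apply: eq_bigr => i _; apply: FG.
by rewrite -size_cat cat_take_drop.
Qed.

Lemma eq_lam_bar f g s : (forall t, lam (f t) = lam (g t)) ->
  lam (bar f s) = lam (bar g s).
Proof.
elim: s f g => [|a s IH] f g fg //=; rewrite !scalarE.
rewrite (IH (fun t => f (a :: t)) (fun t => g (a :: t))) //.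
by case: s {IH} => [|b s]; rewrite ?fg.
Qed.

(** Isolates a marked letter a: merges before it, the merge with its left neighbour, the merge with
    its right neighbour (or with the output), and everything behind it. *)
Lemma rbar_cat f a v u :
  rbar f (v ++ a :: u)
  = bar (fun v' => f (v' ++ a :: u)) v
    + (-1) ^+ size v *: (if v is y :: v' then
                           f (belast y v' ++ last y v' * a :: u) else 0)
    - (-1) ^+ size v *: lmerge (fun t => f (v ++ t)) a u
    - (-1) ^+ size v *: rbar (fun t => f (v ++ a :: t)) u.
Proof.
elim: v f => [|x v IH] f /=; first by lin; ring.
by rewrite IH; case: v {IH} => [|y v] /=; lin; ring.
Qed.

(* The Hochschild differential on the functions K a s that stand for the form *)
(* lam (a * f s), see lam_hochschild.                                         *)
Definition cyclic_hochschild K a s : A :=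
  (if s is x :: s' then K (a * x) s' else 0) + bar (K a) s
  + (-1) ^+ size s *:
      (if s is x :: s' then K (last x s' * a) (belast x s') else 0).

Lemma lam_hochschild f K : (forall a s, lam (a * f s) = lam (K a s)) ->
  forall a s, lam (a * hochschild f s) = lam (cyclic_hochschild K a s).
Proof.
move=> fK a s; rewrite hochschildE rbarE /cyclic_hochschild !mulrDr -!scalerAr
  !scalarE addrA.
congr (_ + _ + _).
- by case: s => [|x s] /=; rewrite ?mulr0 // mulrA fK.
- rewrite -(eq_lam_bar _ (fK a)); congr (lam _).
  elim: s f {fK} => [|x s IH] f /=; first by rewrite mulr0.
  rewrite mulrBr mulrN (IH (fun t => f (x :: t))); congr (- _ - _).
  by case: s {IH} => //; rewrite mulr0.
- congr (_ * _).
  case: s => [|x s] /=; first by rewrite mulr0.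
  by rewrite mulrA lamC mulrA fK.
Qed.

(** For s = u ++ v, the block v is rotated in front of a :: u, with the sign of a cyclic
    permutation. This is [cyclic_sum f (a :: s)], see [cyclic_sumE]. *)
Definition rotations f a s : A :=
  splits (fun u v => (-1) ^+ (size v * (size u).+1) *: f (v ++ a :: u)) s.

(** Merging two cyclically adjacent letters and rotating commute up to sign, so those terms ([D])
    match. The outer multiplications in df have no counterpart on the left, and cancel in pairs
    because lam is a trace. *)
Lemma lam_cyclic_hochschild_rotations f a s :
  lam (cyclic_hochschild (rotations f) a s) = - lam (rotations (hochschild f) a
    s).
Proof.
pose sg u v : k := (-1) ^+ (size v * (size u).+1).
(* [P] multiplies on the left by the first letter of the rotated word, [Q] on the right by its last
   letter. The trace property and the transfer of that letter across the cut identify them. *)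
pose P u v := if v is y :: v' then sg u (y :: v') *: (y * f (v' ++ a :: u))
  else 0.
pose Q u v := (-1) ^+ (size v + size u) * sg u v *: rmul (fun t => f (v ++ a ::
  t)) u.
have PQ : lam (splits P s) = lam (splits Q s).
  rewrite /P (splits_shift (fun u y v' => sg u (y :: v') *: (y * f (v' ++ a ::
    u)))).
  apply: eq_lam_splits => -[|x u] v _ /=; rewrite !scalarE;
    first by rewrite mulr0.
  rewrite lamC /sg /= size_belast; sring.
pose D u v := (-1) ^+ (size v * size u) *: ((if u is x :: u' then
      f (v ++ a * x :: u') else 0) + bar (fun t => f (v ++ a :: t)) u)
  - sg u v *: bar (fun t => f (t ++ a :: u)) v
  - (-1) ^+ (size v * size u) *: (if v is y :: v' then
      f (belast y v' ++ last y v' * a :: u) else 0).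
have -> : cyclic_hochschild (rotations f) a s = splits D s.
  rewrite /cyclic_hochschild bar_splits.
  rewrite [X in X + _ + _](_ : _ = splits (fun u v => if u is x :: u' then
    (-1) ^+ (size v * (size u').+1) *: f (v ++ a * x :: u') else 0) s);
      last first.
    rewrite (splits_behead (fun x u v => (-1) ^+ (size v * (size u).+1) *:
      f (v ++ a * x :: u))); by case: s {PQ}.
  rewrite [X in _ + X](_ : _ = splits (fun u v => if v is y :: v' then
    (-1) ^+ size s * (-1) ^+ (size (belast y v') * (size u).+1) *:
     f (belast y v' ++ last y v' * a :: u) else 0) s); last first.
    rewrite (splits_last (fun u v' y => (-1) ^+ size s *
      (-1) ^+ (size v' * (size u).+1) *: f (v' ++ y * a :: u))).
    case: s {PQ} => [|x s]; first by rewrite scaler0.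
    by rewrite -splitsZ; apply: eq_splits => u v _; rewrite scalerA.
  rewrite -!splitsD; apply: eq_splits => u v uv; rewrite /D /sg.
  rewrite (bar_size (fun n => (-1) ^+ (size v * n))).
  rewrite (eq_bar v (g := fun t => (-1) ^+ ((size t).+1 * (size u).+1).+1 *
    (-1) ^+ size u *: f (t ++ a :: u))); last first.
    by move=> t; congr (_ *: _); sring.
  rewrite (bar_size (fun n => (-1) ^+ (n * (size u).+1).+1 * (-1) ^+ size u)).
  move: (bar _ u) (bar _ v) => B1 B2; rewrite -uv.
  by case: u {uv} => [|x u]; case: v => [|y v]; rewrite ?size_belast /=; lin;
    sring.
have -> : rotations (hochschild f) a s = splits (fun u v => P u v
    + (if v is [::] then a * f u else 0)
    - (if u is [::] then f v * a else 0) - Q u v - D u v) s.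
  apply: eq_splits => u v _; rewrite hochschildE rbar_cat rbarE /P /Q /D /sg.
  by case: u => [|x u]; case: v => [|y v] //=; rewrite ?cats0; lin;
    sring.
rewrite !splitsB splitsD !scalarE PQ.
rewrite (splits_nilr (fun u => a * f u)) (splits_nill (fun u => f u * a)) lamC.
ring.
Qed.
End Cyclic.

(** * The homotopy between rotations of a cup product and insertions *)

Section Homotopy.
Variables (k : fieldType) (A : falgType k) (lam : {scalar A}).
Hypothesis lamC : forall x y : A, lam (x * y) = lam (y * x).
Implicit Types (f g F : seq A -> A) (a : A) (s t u v w : seq A).

Lemma multilinear_cat f v : multilinear f -> multilinear (fun t => f (v ++ t)).
Proof. by move=> lf s t c x y; rewrite !catA lf. Qed.

Lemma insertion_bar n (F : seq A -> seq A -> A) g v t :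
  insertion n (fun r => bar (F^~ r) v) g t = bar (fun v' => insertion n (F v')
    g t) v.
Proof.
elim: v F => [|x v IH] F /=.
  by rewrite insertion_vanish.
rewrite insertionD !insertionN (IH (fun v' => F (x :: v'))); congr (- _ - _).
by case: v {IH} => //; apply: insertion_vanish.
Qed.

(* The part of rotations (cup f g) where a is an argument of f *)
Definition rotations_left f g a s : A :=
  splits (fun t v => splits (fun u w => (-1) ^+ (size v * (size t).+1) *:
    (f (v ++ a :: u) * g w)) t) s.

(* The rotations of the cyclic word (a, s), evaluated by f after an insertion *)
(* of g on the right of a. This is the homotopy behind the BV formula.        *)
Definition rotation_homotopy n f g a s : A :=
  splits (fun t v => (-1) ^+ (size v * (size t + n)) *:
    insertion n (fun r => f (v ++ a :: r)) g t) s.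

Section Degrees.
Variables (m n : nat) (f g : seq A -> A).
Hypotheses (lf : multilinear f) (hf : homogeneous m f) (hg : homogeneous n g).

Lemma cup_cat v a u :
  cup f g (v ++ a :: u) = splits (fun v1 v2 => f v1 * g (v2 ++ a :: u)) v
    + splits (fun u1 u2 => f (v ++ a :: u1) * g u2) u.
Proof.
clear; elim: v f => [|x v IH] F; first by rewrite splits_nil cup_cons.
by rewrite /= cup_cons IH splits_cons addrA.
Qed.

(** In a rotated word the cut between f and g lies behind a or in front of it. In the second case
    the trace exchanges the two factors, and a becomes an argument of the leading factor g. *)
Lemma lam_rotations_cup a s :
  lam (rotations (cup f g) a s)
  = lam (rotations_left f g a s) + (-1) ^+ (m * n) * lam (rotations_left g f a
    s).
Proof.
transitivity (lam (splits (fun u v => splits (fun v1 v2 =>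
   (-1) ^+ ((size v1 + size v2) * (size u).+1) *: (f v1 * g (v2 ++ a :: u))) v)
     s)
   + lam (rotations_left f g a s)).
  rewrite -[LHS]/(lam (splits _ s)) /rotations_left -scalarE -splitsD;
    congr (lam _).
  apply: eq_splits => u v _; rewrite cup_cat scalerDr -!splitsZ; congr (_ + _).
  by apply: eq_splits => v1 v2 ->.
rewrite addrC; congr (_ + _).
rewrite -splits_assoc /rotations_left -scalarE -splitsZ;
  apply: eq_lam_splits => t v _.
rewrite -splitsZ; apply: eq_lam_splits => u w <-; rewrite !scalarE lamC.
case: (eqVneq (size w) m) => [<-|wm]; last by rewrite hf // mulr0 !raddf0
  !mulr0.
case: (eqVneq (size (v ++ a :: u)) n) => [<-|vn].
  by rewrite size_cat /=; sring.
by rewrite (hg vn) mul0r !raddf0 !mulr0.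
Qed.

Hypotheses (df : forall s, hochschild f s = 0) (dg : forall s,
  hochschild g s = 0).

(** Each term comes from df = 0 on a rotated word with g inserted to the right of a. Left
    multiplication by a itself gives f o g; right multiplication by the value of g gives
    [rotations_left]; the merge of a with the value of g gives the rotations of f at a * g w, that
    is g u Delta f. All other terms belong to the differential of the homotopy or cancel under the
    trace. *)
Lemma lam_cyclic_hochschild_homotopy a s :
  lam (cyclic_hochschild (rotation_homotopy n f g) a s)
  = - (-1) ^+ n * lam (a * insertion n f g s) - (-1) ^+ (m * n) * lam
    (rotations_left f g a s)
    + (-1) ^+ n * lam (splits (fun w r => rotations f (a * g w) r) s).
Proof.
pose Z v x := insertion n (fun r => f (v ++ x :: r)) g.
pose sg t v : k := (-1) ^+ (size v * (size t + n)).
pose P t v := if v is y :: v' then sg t (y :: v') *: (y * Z v' a t) else 0.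
pose Q t v := (-1) ^+ (n + size v + size t).+1 * sg t v *: rmul (Z v a) t.
have PQ : lam (splits P s) = lam (splits Q s).
  rewrite /P (splits_shift (fun t y v' => sg t (y :: v') *: (y * Z v' a t))).
  apply: eq_lam_splits => -[|x t] v _; rewrite !scalarE /sg /=.
    by rewrite mulr0.
  rewrite lamC size_belast; sring.
pose T t v := if t is x :: t' then Z v (a * x) t' else 0.
pose W t v := if v is y :: v' then Z (belast y v') (last y v' * a) t else 0.
pose D t v := (-1) ^+ (size v) * sg t v *: (T t v + bar (Z v a) t)
  + (-1) ^+ n * sg t v *: (bar (fun v' => Z v' a t) v + (-1) ^+ size v *: W t
    v).
have -> : cyclic_hochschild (rotation_homotopy n f g) a s = splits D s.
  rewrite /cyclic_hochschild bar_splits.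
  rewrite [X in X + _ + _](_ : _ = splits (fun t v => if t is x :: t' then
    (-1) ^+ (size v * (size t' + n)) *: Z v (a * x) t' else 0) s); last first.
    by rewrite (splits_behead (fun x t v => (-1) ^+ (size v * (size t + n)) *:
      Z v (a * x) t)); case: s {PQ}.
  rewrite [X in _ + X](_ : _ = splits (fun t v => if v is y :: v' then
    (-1) ^+ size s * (-1) ^+ (size (belast y v') * (size t + n)) *:
     Z (belast y v') (last y v' * a) t else 0) s); last first.
    rewrite (splits_last (fun t v' y => (-1) ^+ size s *
      (-1) ^+ (size v' * (size t + n)) *: Z v' (y * a) t)).
    case: s {PQ} => [|x s]; first by rewrite scaler0.
    by rewrite -splitsZ; apply: eq_splits => u v _; rewrite scalerA.
  rewrite -!splitsD; apply: eq_splits => t v tv; rewrite /D /sg /T /W.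
  rewrite (eq_bar t (g := fun r => (-1) ^+ (size v * ((size r).+1 + n)) *
    (-1) ^+ size v *: Z v a r)); last by move=> r; congr (_ *: _); sring.
  rewrite (bar_size (fun i => (-1) ^+ (size v * (i + n)) * (-1) ^+ size v)).
  rewrite (eq_bar v (g := fun r => (-1) ^+ ((size r).+1 * (size t + n)) *
    (-1) ^+ (size t + n) *: Z r a t)); last by move=> r; congr (_ *: _); sring.
  rewrite (bar_size (fun i => (-1) ^+ (i * (size t + n)) * (-1) ^+ (size t +
    n))).
  move: (bar _ t) (bar _ v) => B1 B2; rewrite -tv.
  by case: t {tv} => [|x t]; case: v => [|y v]; rewrite ?size_belast /=; lin;
    sring.
(* [R] merges the marked letter with the value of g inserted directly behind it. *)
pose R t v := splits (fun w z => f (v ++ a * g w :: z)) t.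
have E t v : D t v = (if v is [::] then - (-1) ^+ n *: (a * insertion n f g t)
  else 0)
   - (-1) ^+ n *: P t v + (-1) ^+ n *: Q t v
   + (-1) ^+ (n + size v) * sg t v *: R t v
   - (-1) ^+ (n + size v) * sg t v *: twisted_cup n (fun r => f (v ++ a :: r))
     g t.
  pose L := if v is y :: v' then y * Z v' a t else a * insertion n f g t.
  (* This is df = 0 at [v ++ a :: r], with g inserted into r. [L] is the left multiplication, by a
     when v is empty; [W] and [T] merge a with its left and right neighbours. *)
  have H : L + bar (fun v' => Z v' a t) v + (-1) ^+ size v *: W t v
    - (-1) ^+ size v *: (R t v + (-1) ^+ n.+1 *: T t v)
    + (-1) ^+ (size v + n) *: (bar (Z v a) t + (-1) ^+ size t *: rmul (Z v a) t
        + (-1) ^+ n *: twisted_cup n (fun r => f (v ++ a :: r)) g t) = 0.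
    transitivity (insertion n (fun r => hochschild f (v ++ a :: r)) g t);
      last first.
      by apply: insertion_vanish => x r; exact: df.
    have lfv : multilinear (fun r => f (v ++ a :: r)).
      exact: multilinear_cons (multilinear_cat v lf).
    rewrite (eq_insertion _ _ _ (G := fun r => lmul f (v ++ a :: r)
      + bar (fun v' => f (v' ++ a :: r)) v
      + (-1) ^+ size v *: (if v is y :: v' then
                             f (belast y v' ++ last y v' * a :: r) else 0)
      + - (-1) ^+ size v *: lmerge (fun t => f (v ++ t)) a r
      + - (-1) ^+ size v *: rbar (fun t => f (v ++ a :: t)) r)); last first.
      by move=> x r; rewrite hochschildE rbar_cat; lin; ring.
    rewrite !insertionD !insertionZ (insertion_bar n (fun v' r => f (v' ++ a ::
      r))) insertion_lmerge.
    have := rbar_insertion t lfv hg; rewrite insertion0 // sub0r rbarE.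
    rewrite -/(Z v a) => ->.
    have -> : insertion n (fun r => lmul f (v ++ a :: r)) g t = L.
      by rewrite /L /Z; case: (v) => [|y v'] /=; rewrite insertionMl.
    have -> : insertion n (fun r => if v is y :: v' then
                   f (belast y v' ++ last y v' * a :: r) else 0) g t = W t v.
      by rewrite /W; case: (v) => [|y v'] //; apply: insertion_vanish.
    rewrite /R /T /Z; case: (t) => [|x t'] /=; lin; sring.
  apply/eqP; rewrite -subr_eq0; apply/eqP.
  rewrite -[RHS](scaler0 _ ((-1) ^+ n * sg t v)) -[in RHS]H.
  rewrite /D /L /P /Q /sg; move: (bar _ t) (bar _ v) (W t v) => B1 B2 W'.
  by case: (v) => [|y v'] /=; lin; sring.
have I3 : splits (fun t v => (-1) ^+ (n + size v) * sg t v *: R t v) s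
   = (-1) ^+ n *: splits (fun w r => rotations f (a * g w) r) s.
  transitivity (splits (fun t v => splits (fun w z => (-1) ^+ n *:
    ((-1) ^+ (size v * (size z).+1) *: f (v ++ a * g w :: z))) t) s).
    apply: eq_splits => t v _; rewrite -splitsZ; apply: eq_splits => w z tE.
    have /orP[/eqP wn|/eqP gw0] := homogeneousP w hg.
      by rewrite /sg -tE wn; lin; sring.
    by rewrite gw0 mulr0 (head0 (multilinear_cat v lf)) !scaler0.
  rewrite splits_assoc -splitsZ; apply: eq_splits => w r _.
  by rewrite /rotations -splitsZ.
have I4 : splits (fun t v => (-1) ^+ (n + size v) * sg t v *:
     twisted_cup n (fun r => f (v ++ a :: r)) g t) s = (-1) ^+ (m * n) *:
       rotations_left f g a s.
  rewrite /rotations_left -splitsZ; apply: eq_splits => t v _;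
    rewrite /twisted_cup -!splitsZ.
  apply: eq_splits => u w tE.
  have /orP[/eqP wn|/eqP gw0] := homogeneousP w hg;
    last by rewrite gw0 mulr0 !scaler0.
  have /orP[/eqP vm|/eqP fv0] := homogeneousP (v ++ a :: u) hf.
    by rewrite /sg -tE wn -vm size_cat /=; lin; sring.
  by rewrite fv0 mul0r !scaler0.
rewrite (eq_splits (fun t v _ => E t v)) splitsB I4 splitsD I3 splitsD splitsB
  !splitsZ !scalarE PQ.
rewrite (splits_nilr (fun t => - (-1) ^+ n *: (a * insertion n f g t)))
  !scalarE.
ring.
Qed.
End Degrees.
End Homotopy.

(** * Cochains, duality and normalization *)

Section Multilinearity.
Variables (k : fieldType) (A : falgType k).
Implicit Types (f g h F : seq A -> A) (s t u v w : seq A) (m n p : nat).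

Definition bounded n f := forall s, (n <= size s)%N -> f s = 0.

Lemma homogeneous_bounded n f : homogeneous n f -> bounded n.+1 f.
Proof. by move=> hf s ns; rewrite hf // gtn_eqF. Qed.

Lemma multilinear_splits (F : seq A -> seq A -> A) :
  (forall v, multilinear (F^~ v)) -> (forall u, multilinear (F u)) ->
  multilinear (splits F).
Proof.
move=> + + s t c x y; elim: s F => [|a s IH] F lF1 lF2 /=.
  rewrite !splits_cons (lF2 [::] [::]) /=.
  rewrite (eq_splits (G := fun u v => c *: F (x :: u) v + F (y :: u) v)).
    by rewrite splitsD splitsZ; lin; ring.
  by move=> u v _; rewrite (lF1 v [::]).
rewrite !splits_cons (lF2 [::] (a :: s)) /= IH //; first by lin; ring.
by move=> v; apply: (@multilinear_cons _ _ (F^~ v)).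
Qed.

Lemma multilinear_size (G : nat -> k) f :
  multilinear f -> multilinear (fun s => G (size s) *: f s).
Proof. by move=> lf s t c x y; rewrite lf !size_cat /=; lin; ring. Qed.

Lemma multilinearZ c f : multilinear f -> multilinear (fun s => c *: f s).
Proof. exact: (@multilinear_size (fun=> c)). Qed.

Lemma multilinearD f g :
  multilinear f -> multilinear g -> multilinear (fun s => f s + g s).
Proof. by move=> lf lg s t c x y; rewrite lf lg; lin; ring. Qed.

Lemma multilinearMl a f : multilinear f -> multilinear (fun s => a * f s).
Proof. by move=> lf s t c x y; rewrite lf mulrDr scalerAr. Qed.

Lemma multilinearMr a f : multilinear f -> multilinear (fun s => f s * a).
Proof. by move=> lf s t c x y; rewrite lf mulrDl scalerAl. Qed.

Lemma multilinear_catr f v : multilinear f -> multilinear (fun t => f (t ++ v)).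
Proof. by move=> lf s t c x y; rewrite -!catA !cat_cons lf. Qed.

Lemma multilinear_head_comp f g v :
  multilinear f -> multilinear g -> multilinear (fun t => f (g t :: v)).
Proof. by move=> lf lg s t c x y; rewrite lg (lf [::]). Qed.

Lemma multilinear_cup f g :
  multilinear f -> multilinear g -> multilinear (cup f g).
Proof.
move=> lf lg; apply: (@multilinear_splits (fun u v => f u * g v)) => [v|u].
- exact: multilinearMr.
- exact: multilinearMl.
Qed.

Lemma multilinear_insert_head f g : multilinear f -> multilinear g ->
  multilinear (insert_head g f).
Proof.
move=> lf lg; apply: (@multilinear_splits (fun w v => f (g w :: v))) => [v|w].
- exact: multilinear_head_comp.
- exact: multilinear_cons.
Qed.

Lemma multilinear_insertion n f g : multilinear f -> multilinear g ->
  multilinear (insertion n f g).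
Proof.
move=> + lg s t c x y; elim: s f => [|a s IH] f lf /=.
  rewrite (multilinear_insert_head lf lg [::]) (eq_insertion _ _ _
    (G := fun t => c *: f (x :: t) + f (y :: t))) ?insertionD ?insertionZ.
    by lin; ring.
  by move=> z r; rewrite (lf [::]).
rewrite (multilinear_insert_head lf lg (a :: s)) IH; first by lin; ring.
exact: multilinear_cons.
Qed.

Lemma multilinear_insert_head2 p f g h :
  multilinear f -> multilinear g -> multilinear h ->
  multilinear (insert_head2 p f g h).
Proof.
move=> lf lg lh; apply: (@multilinear_splits
  (fun w v => insertion p (fun t => f (g w :: t)) h v)) => [v|w]; last first.
  exact: multilinear_insertion (multilinear_cons _ lf) lh.
move=> s t c x y; rewrite -insertionZ -insertionD; apply: eq_insertion => z r.
by rewrite (multilinear_head_comp _ lf lg).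
Qed.

Lemma braceZ n p c f g h s :
  brace n p (fun t => c *: f t) g h s = c *: brace n p f g h s.
Proof.
elim: s f => [|a s IH] f /=; rewrite /insert_head2.
  by rewrite !splits_nil insertionZ; lin; ring.
rewrite (IH (fun t => f (a :: t))) scalerDr; congr (_ + _); last by lin; ring.
by rewrite -splitsZ; apply: eq_splits => w v _; rewrite insertionZ.
Qed.

Lemma multilinear_brace n p f g h :
  multilinear f -> multilinear g -> multilinear h ->
  multilinear (brace n p f g h).
Proof.
move=> + lg lh s t c x y; elim: s f => [|a s IH] f lf /=.
  rewrite (multilinear_insert_head2 _ lf lg lh [::]) (eq_brace _ _ _ _ _
    (G := fun t => c *: f (x :: t) + f (y :: t))) ?braceD ?braceZ.
    by lin; ring.
  by move=> r; rewrite (lf [::]).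
rewrite (multilinear_insert_head2 _ lf lg lh (a :: s)) IH; first by lin; ring.
exact: multilinear_cons.
Qed.

Lemma multilinear_hochschild f : multilinear f -> multilinear (hochschild f).
Proof.
move=> lf s t c x y; rewrite !hochschildE.
have L : multilinear (lmul f).
  move=> [|b r] r' d z w /=; first by rewrite mulrDl scalerAl.
  by rewrite lf mulrDr scalerAr.
have M a F : multilinear F -> multilinear (lmerge F a).
  move=> lF [|b r] r' d z w /=; last by rewrite (lF (a * b :: r)).
  by rewrite mulrDr -scalerAr (lF [::]).
rewrite L.
suff -> : rbar f (s ++ (c *: x + y) :: t)
    = c *: rbar f (s ++ x :: t) + rbar f (s ++ y :: t) by lin; ring.
elim: s f lf {L} => [|a s IH] f lf /=; last first.
  rewrite M // IH; first by lin; ring.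
  exact: multilinear_cons.
rewrite (eq_rbar _ (g := fun t => c *: f (x :: t) + f (y :: t))); last first.
  by move=> r; rewrite (lf [::]).
rewrite rbarD rbarZ; case: t => [|b t] /=.
  by rewrite mulrDr -scalerAr; lin; ring.
by rewrite mulrDl -scalerAl (lf [::]); lin; ring.
Qed.

Lemma bounded_cons m f a : bounded m f -> bounded m.-1 (fun t => f (a :: t)).
Proof. by move=> bf t mt; apply: bf => /=; lia. Qed.

Lemma bounded_insertion m n f g : multilinear f -> bounded m f -> homogeneous n
  g ->
  bounded (m + n) (insertion n f g).
Proof.
move=> + + hg s; elim: s m f => [|a s IH] m f lf bf /= ms.
all: rewrite [insert_head _ _ _](_ : _ = 0) ?add0r.
- by [].
- rewrite -[RHS](splits0 [::]); apply: eq_splits => w v /= wv.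
  have /orP[/eqP wn|/eqP->] := homogeneousP w hg; last exact: head0.
  by apply: bf => /=; lia.
- case: m bf ms => [|m] bf ms.
    by rewrite insertion_vanish ?scaler0 // => x t; apply: bf.
  rewrite (IH m) ?scaler0 //; first exact: multilinear_cons.
  exact: (bounded_cons _ bf).
- rewrite -[RHS](splits0 (a :: s)); apply: eq_splits => w v /= wv.
  have /orP[/eqP wn|/eqP->] := homogeneousP w hg; last exact: head0.
  by apply: bf => /=; lia.
Qed.

Lemma bounded_brace m n p f g h : multilinear f -> bounded m f ->
  homogeneous n g -> homogeneous p h -> bounded (m + n + p) (brace n p f g h).
Proof.
move=> + + hg hh s; elim: s m f => [|a s IH] m f lf bf /= ms.
all: rewrite [insert_head2 _ _ _ _ _](_ : _ = 0) ?add0r.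
- by [].
- rewrite -[RHS](splits0 [::]); apply: eq_splits => w v /= wv.
  have /orP[/eqP wn|/eqP->] := homogeneousP w hg;
    last by rewrite insertion_cons0.
  by apply: bounded_insertion (multilinear_cons _ lf) (bounded_cons _ bf) hh _
    _; lia.
- case: m bf ms => [|m] bf ms.
    rewrite (eq_brace _ _ _ _ _ (G := fun t => 0 *: f t)) ?braceZ ?scale0r
      ?scaler0 //.
    by move=> t; rewrite bf // scale0r.
  rewrite (IH m) ?scaler0 //; first exact: multilinear_cons.
  exact: (bounded_cons _ bf).
- rewrite -[RHS](splits0 (a :: s)); apply: eq_splits => w v /= wv.
  have /orP[/eqP wn|/eqP->] := homogeneousP w hg;
    last by rewrite insertion_cons0.
  by apply: bounded_insertion (multilinear_cons _ lf) (bounded_cons _ bf) hh _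
    _; lia.
Qed.

Lemma bounded_cup m n f g : bounded m f -> bounded n g ->
  bounded (m + n) (cup f g).
Proof.
move=> bf bg s ms; rewrite cupE -[RHS](splits0 s); apply: eq_splits => u v uv.
case: (leqP m (size u)) => [mu | um]; first by rewrite bf ?mul0r.
by rewrite bg ?mulr0 //; lia.
Qed.

Lemma homogeneous_cup m n f g : homogeneous m f -> homogeneous n g ->
  homogeneous (m + n) (cup f g).
Proof.
move=> hf hg s ms; rewrite cupE -[RHS](splits0 s); apply: eq_splits => u v uv.
case: (eqVneq (size u) m) => [um|um]; last by rewrite hf ?mul0r.
by rewrite hg ?mulr0 //; lia.
Qed.

Lemma bounded_hochschild n f : bounded n f -> bounded n.+1 (hochschild f).
Proof.
move=> bf s; rewrite hochschildE; case: s => // a s; rewrite ltnS /= => ns.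
rewrite bf // mulr0 add0r.
elim: s n a f bf ns => [|b s IH] n a f bf /= ns.
  by rewrite bf // mul0r !oppr0 addr0.
by rewrite bf // oppr0 (IH n.-1 b (fun t => f (a :: t))) ?oppr0 ?addr0 //;
  [exact: bounded_cons | lia].
Qed.

End Multilinearity.

(** * Representing linear forms by the non-degenerate trace form *)

Section Duality.
Variables (k : fieldType) (A : falgType k) (lam : {scalar A}).
Hypothesis lam_nondegenerate :
  forall a : A, (forall b : A, lam (b * a) = 0) -> a = 0.

Lemma lam_inj (x y : A) : (forall b : A, lam (b * x) = lam (b * y)) -> x = y.
Proof.
move=> xy; apply/eqP; rewrite -subr_eq0; apply/eqP/lam_nondegenerate => b.
by rewrite mulrBr raddfB /= xy subrr.
Qed.

(** The map sending d to the values lam (e_i * d) on a basis is injective by non-degeneracy, hence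
    surjective by dimension. *)
Lemma riesz_ex (L : {scalar A}) : exists d : A, forall a : A, lam (a * d) = L a.
Proof.
pose n := \dim {: A}.
pose e := vbasis {: A}.
pose phi (d : A) : 'rV[k]_n := \row_i lam (e`_i * d).
have phi_lin : linear phi.
  by move=> c x y; apply/rowP => i; rewrite !mxE mulrDr -scalerAr !scalarE.
pose phiL := GRing.isLinear.Build _ _ _ _ phi phi_lin.
pose phi' : {linear A -> 'rV[k]_n} := HB.pack phi phiL.
have ext (d a : A) : phi d = \row_i L e`_i -> lam (a * d) = L a.
  move=> /rowP E; rewrite (coord_vbasis (memvf a)) mulr_suml !linear_sum.
  apply: eq_bigr => i _; rewrite -scalerAl !scalarE.
  by have := E i; rewrite !mxE => ->.
have ker0 : lker (linfun phi') == 0%VS.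
  apply/lker0P => x y; rewrite !lfunE /= => /rowP E; apply: lam_inj => b.
  rewrite (coord_vbasis (memvf b)) !mulr_suml !linear_sum.
  apply: eq_bigr => i _; rewrite -!scalerAl !scalarE.
  by have := E i; rewrite !mxE => ->.
have : (\row_i L e`_i : 'rV[k]_n) \in limg (linfun phi').
  suff -> : limg (linfun phi') = fullv by rewrite memvf.
  apply/eqP; rewrite eqEdim subvf limg_dim_eq ?(eqP ker0) ?capv0 //.
  by rewrite dimvf /dim /= mul1n.
by case/memv_imgP => d _ E; exists d => a; apply: ext; rewrite E lfunE.
Qed.

Implicit Types (K : A -> seq A -> A) (s : seq A).

(** The default 0 is taken only if no element represents the form; linearity of K in its first
    argument excludes this ([dualP]). *)
Definition dual K s : A :=
  if pselect (exists d : A, forall a : A, lam (a * d) = lam (K a s)) is left e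
  then sval (cid e) else 0.

Lemma dualP K s : linear (K^~ s) -> forall a, lam (a * dual K s) = lam (K a s).
Proof.
move=> lK; rewrite /dual; case: pselect => [e|[]]; first exact: svalP (cid e).
pose L (a : A) := lam (K a s) : k^o.
have L_lin : linear L.
  by move=> c x y; rewrite /L lK !scalarE.
pose LL := GRing.isLinear.Build _ _ _ _ L L_lin.
pose L' : {scalar A} := HB.pack L LL.
exact: (riesz_ex L').
Qed.

Lemma multilinear_dual K : (forall s, linear (K^~ s)) ->
  (forall a, multilinear (K a)) -> multilinear (dual K).
Proof.
move=> lK mK s t c x y; apply: lam_inj => b.
by rewrite mulrDr -scalerAr !scalarE !dualP // mK !scalarE.
Qed.

End Duality.

(** * Normalized representatives of Hochschild classes *)

Section Normalization.
Variables (k : fieldType) (A : falgType k).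
Implicit Types (f g h F : seq A -> A) (s t u v w : seq A) (m n p j : nat).

Lemma hochschildD f g s :
  hochschild (fun t => f t + g t) s = hochschild f s + hochschild g s.
Proof.
rewrite !hochschildE rbarD; case: s => [|a s] /=; last by rewrite mulrDr; lin;
  ring.
by rewrite !addr0.
Qed.

Lemma hochschildZ c f s :
  hochschild (fun t => c *: f t) s = c *: hochschild f s.
Proof.
rewrite !hochschildE rbarZ; case: s => [|a s] /=; last by rewrite -scalerAr;
  lin; ring.
by rewrite addr0 !scaler0 addr0.
Qed.

(* Inserting a unit in front of the letter of index j is the contraction used *)
(* to normalize cochains one letter at a time.                                *)
Fixpoint insert_unit j f s : A :=
  if j is j'.+1 then
    if s is a :: s' then insert_unit j' (fun t => f (a :: t)) s' else 0
  else f (1 :: s).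

Definition normalized_upto j f :=
  forall u v, (size u < j)%N -> f (u ++ 1 :: v) = 0.

Lemma insert_unit_cat j f u v :
  size u = j -> insert_unit j f (u ++ v) = f (u ++ 1 :: v).
Proof.
elim: u j f => [|a u IH] [|j] f //= [uj].
by rewrite (IH j (fun t => f (a :: t))).
Qed.

Lemma insert_unit0 j f s : f =1 (fun=> 0) -> insert_unit j f s = 0.
Proof.
elim: j s f => [|j IH] [|a s] f f0 //=; rewrite ?f0 //.
by rewrite IH.
Qed.

Lemma normalized_upto_cons j f a :
  normalized_upto j.+1 f -> normalized_upto j (fun t => f (a :: t)).
Proof. by move=> nf u v uj; apply: (nf (a :: u)). Qed.

Lemma normalized_upto_insert_unit j f :
  normalized_upto j f -> normalized_upto j (insert_unit j f).
Proof.
elim: j f => [|j IH] f nf // [|a u] v /= uj.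
  by apply: insert_unit0 => t; apply: (nf [::]).
by apply: (IH _ (normalized_upto_cons a nf)).
Qed.

(** The two products of the unit with its neighbours give the same word with opposite signs; every
    other term keeps a unit at an index below j. *)
Lemma normalized_upto_hochschild j f :
  normalized_upto j f -> normalized_upto j (hochschild f).
Proof.
move=> nf u v; rewrite hochschildE.
have R0 : (0 < j)%N -> rbar f (1 :: v) = - f v.
  move=> j0 /=; rewrite (eq_rbar v (g := fun t => 0 *: f t)); last first.
    by move=> t; rewrite scale0r (nf [::]).
  by rewrite rbarZ scale0r subr0; case: v => [|b v] /=; rewrite ?mul1r ?mulr1.
case: u => [|a u] uj; first by rewrite R0 // /= mul1r addrN.
rewrite /= nf ?mulr0 ?add0r; last exact: ltnW.
have -> : lmerge f a (u ++ 1 :: v) = if u is [::] then f (a :: v) else 0.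
  case: u uj => [|b u] uj /=; first by rewrite mulr1.
  by apply: (nf (a * b :: u)); apply: ltnW.
elim: u j a f nf uj {R0} => [|b u IH] [|j] a f nf uj //=.
  rewrite (eq_rbar v (g := fun t => 0 *: f t)); last first.
    by move=> t; rewrite scale0r (nf [:: a]).
  rewrite rbarZ scale0r subr0.
  by case: v => [|c v] /=; rewrite ?mul1r ?mulr1 opprK addNr.
rewrite oppr0 add0r -/(lmerge _ _ _).
have := IH j b (fun t => f (a :: t)) (normalized_upto_cons a nf) uj.
case: u {IH} uj => [|c u] uj /=.
  by rewrite mulr1 => ->; rewrite oppr0.
by rewrite (nf [:: a, b * c & u]) => [->|]; [rewrite oppr0 | apply: ltnW].
Qed.

(** For j = 0 the sign is exceptional: left multiplication by the leading unit, which [rbar] leaves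
    out, does not vanish there. *)
Lemma rbar_insert_unit j f u v : normalized_upto j f -> size u = j ->
  rbar (insert_unit j f) (u ++ 1 :: v)
  = (if j is 0 then -1 else (-1) ^+ j) *: f (u ++ 1 :: v)
    - rbar f (u ++ 1 :: 1 :: v).
Proof.
elim: u j f => [|a u IH] [|j] f nf //= => [_|[uj]].
  rewrite mul1r opprB opprK.
  have E : lmerge (fun t => f (1 :: t)) 1 v = f (1 :: v).
    by case: v => [|b v] /=; rewrite ?mul1r ?mulr1.
  by rewrite !E; lin; ring.
rewrite (IH j (fun t => f (a :: t)) (normalized_upto_cons a nf) uj).
have -> : lmerge f a (u ++ 1 :: 1 :: v) = if u is [::] then f (a :: 1 :: v)
  else 0.
  case: u uj {IH} => [|b u] uj /=; first by rewrite mulr1.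
  by apply: (nf (a * b :: u)); rewrite -uj.
have -> : lmerge (insert_unit j.+1 f) a (u ++ 1 :: v)
    = if u is [::] then f (a :: 1 :: v) else 0.
  case: u uj {IH} => [|b u] uj /=.
    by case: j uj {nf} => //= _; rewrite mulr1.
  have := @insert_unit_cat j (fun t => f (a * b :: t)) (rcons u 1) v.
  rewrite size_rcons -uj cat_rcons => -> //.
  by rewrite cat_rcons; apply: (nf (a * b :: u)); rewrite -uj.
case: u j uj {IH nf} => [|b u] [|j] //= _; lin; sring.
Qed.

(** The cocycle condition at [u ++ 1 :: 1 :: v] removes all terms but f itself. Subtracting (-1)^j
    times this coboundary thus makes f vanish on words with a unit at index j. *)
Lemma hochschild_insert_unit j f u v :
  normalized_upto j f -> (forall s, hochschild f s = 0) -> size u = j ->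
  hochschild (insert_unit j f) (u ++ 1 :: v) = (-1) ^+ j *: f (u ++ 1 :: v).
Proof.
move=> nf df uj; rewrite hochschildE rbar_insert_unit //.
have := df (u ++ 1 :: 1 :: v); rewrite hochschildE => /eqP.
rewrite addrC addr_eq0 => /eqP->; rewrite opprK.
case: u j uj nf => [|a u] [|j] //= uj nf.
  by rewrite !mul1r scaleN1r scale1r; lin; ring.
have E : f (u ++ 1 :: 1 :: v) = 0 by apply: nf; rewrite -uj.
have /= := @insert_unit_cat j.+1 f (rcons u 1) v.
rewrite size_rcons uj !cat_rcons => -> //.
by rewrite E mulr0 !addr0 add0r.
Qed.

Lemma insert_unit_linear j c f g s :
  insert_unit j (fun t => c *: f t + g t) s = c *: insert_unit j f s +
    insert_unit j g s.
Proof.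
elim: j f g s => [|j IH] f g [|a s] //=; first by rewrite scaler0 addr0.
Qed.

Lemma multilinear_insert_unit j f : multilinear f -> multilinear (insert_unit j
  f).
Proof.
move=> lf s t c x y; elim: j f s lf => [|j IH] f s lf /=.
  by rewrite -!cat_cons lf.
case: s => [|a s] /=; last by rewrite IH //; apply: multilinear_cons.
rewrite -insert_unit_linear; congr (insert_unit _ _ _).
by apply/funext => r; rewrite (lf [::]).
Qed.

Lemma bounded_insert_unit n j f : bounded n.+1 f -> bounded n (insert_unit j f).
Proof.
elim: j n f => [|j IH] n f bf [|a s] //= ns; rewrite ?bf //.
case: n bf ns => [|n] bf ns.
  by apply: insert_unit0 => t; apply: bf.
by apply: IH ns => t nt; apply: bf.
Qed.

Lemma normalized_upto_ex j n f : multilinear f -> bounded n.+1 f ->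
  (forall s, hochschild f s = 0) ->
  exists h, [/\ multilinear h, bounded n h &
    normalized_upto j (fun s => f s + hochschild h s)].
Proof.
move=> lf bf df; elim: j => [|j [h [lh bh nh]]].
  exists (fun=> 0); split=> // s t c x y; by rewrite scaler0 addr0.
pose f' s := f s + hochschild h s.
have lf' : multilinear f' := multilinearD lf (multilinear_hochschild lh).
have bf' : bounded n.+1 f'.
  by move=> s ns; rewrite /f' bf // (bounded_hochschild bh) // addr0.
have df' s : hochschild f' s = 0.
  by rewrite hochschildD df hochschild_hochschild addr0.
exists (fun s => h s + - (-1) ^+ j *: insert_unit j f' s); split.
- apply: multilinearD => //; apply: multilinearZ;
  exact: multilinear_insert_unit.
- move=> s ns; rewrite bh // add0r (@bounded_insert_unit n j f' bf') ?scaler0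
  //.
- move=> u v uj; rewrite hochschildD hochschildZ addrA -/(f' _).
  move: uj; rewrite ltnS leq_eqVlt => /orP[/eqP uj|uj].
    by rewrite hochschild_insert_unit //; lin; sring.
  rewrite (_ : f' _ = 0) ?add0r; last exact: nh.
  by rewrite (normalized_upto_hochschild (normalized_upto_insert_unit nh))
    ?scaler0.
Qed.

Lemma normalized_ex f : cochain f -> (forall s, hochschild f s = 0) ->
  exists2 h, cochain h & normalized (fun s => f s + hochschild h s).
Proof.
move=> [lf [n bf]] df; have bf' : bounded n.+1 f by move=> s /ltnW; apply: bf.
(* Finitely many corrections suffice: the corrected cochain vanishes on words of length at least
   n.+1, and in a shorter word every index is below n.+1. *)
have [h [lh bh nh]] := normalized_upto_ex n.+1 lf bf' df.
exists h; first by split; last exists n.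
move=> s; case: (leqP n.+1 (size s)) => [ns _|sn].
  by rewrite bf' // (bounded_hochschild bh) // addr0.
move=> s1; case/path.splitPr: s / s1 sn => u v uv.
by apply: nh; move: uv; rewrite size_cat /=; lia.
Qed.

End Normalization.

(** * Cohomology *)

Section Cohomology.
Variables (k : fieldType) (A : falgType k).
Local Open Scope quotient_scope.
Implicit Types (f g h : seq A -> A) (s : seq A) (x y z : HH A) (m n p : nat).

Lemma represents_cocycle f x :
  represents f x -> cochain f /\ forall s, hochschild f s = 0.
Proof.
case=> z <- _; have /asboolP[cz dz] := valP z; split=> // s.
by rewrite dz.
Qed.

Lemma represents_ex f : cochain f -> (forall s, hochschild f s = 0) ->
  exists x, represents f x.
Proof.
move=> cf df; have zf : cocycle f by apply/asboolP; split=> //; apply/funext.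
by exists (\pi_(HH A) (exist _ f zf : Z_HH A)); exists (exist _ f zf).
Qed.

Lemma represents_surj x : exists f, represents f x.
Proof. by exists (val (repr x)); exists (repr x) => //; rewrite reprK. Qed.

Lemma represents_eqP f g x y : represents f x -> represents g y ->
  x = y <-> exists2 h, cochain h & forall s, f s = g s + hochschild h s.
Proof.
case=> z <- <- [w <- <-].
have -> : (\pi_(HH A) z = \pi_(HH A) w) <-> coboundary (z - w).
  split=> [/eqP|H]; last apply/eqP.
  by rewrite (lmod_quotE (GRing.SubmodClosed.clone k _ (@coboundary k A) _)).
  by rewrite (lmod_quotE (GRing.SubmodClosed.clone k _ (@coboundary k A) _)).
split=> [/asboolP[h ch E]|[h ch E]].
  exists h => // s; rewrite -E raddfB /=.
  by rewrite [X in _ + X](_ : _ = val z s - val w s) // addrC subrK.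
apply/asboolP; exists h => //; apply/funext => s; rewrite raddfB /=.
by rewrite [LHS](_ : _ = val z s - val w s) // E addrC addKr.
Qed.

Lemma represents_cohomologous f g h x : represents f x -> cochain g ->
  cochain h -> (forall s, f s = g s + hochschild h s) -> represents g x.
Proof.
move=> fx cg ch E; have [cf df] := represents_cocycle fx.
have dg s : hochschild g s = 0.
  have := df s; rewrite (funext E) hochschildD hochschild_hochschild.
  by rewrite addr0.
have [y gy] := represents_ex cg dg.
suff -> : x = y by [].
by apply/(represents_eqP fx gy); exists h.
Qed.

Lemma represents_linear c f g x y : represents f x -> represents g y ->
  represents (fun s => c *: f s + g s) (c *: x + y).
Proof.
case=> z <- <- [w <- <-]; exists (c *: z + w).
  by rewrite linearP.
pose C := GRing.SubmodClosed.clone k (Z_HH A) (@coboundary k A) _.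
have -> : c *: \pi_(HH A) z = \pi_(HH A) (c *: z) by exact: (@pi_scale _ _ C).
exact: esym (@pi_addE _ _ C _ _).
Qed.

Lemma represents0 : represents (fun=> 0 : A) (0 : HH A).
Proof.
have [f fx] := represents_surj 0.
have := represents_linear (-1) fx fx; rewrite scaler0 addr0.
rewrite (_ : (fun s => -1 *: f s + f s) = (fun=> 0)) //.
by apply/funext => s; rewrite scaleN1r addNr.
Qed.

Lemma represents_inj f x y : represents f x -> represents f y -> x = y.
Proof.
move=> fx fy; apply/(represents_eqP fx fy); exists 0; first exact: cochain0.
by move=> s; rewrite hochschild0 /= addr0.
Qed.

Definition HH_class f : HH A :=
  if pselect (exists x, represents f x) is left e then sval (cid e) else 0.

Lemma represents_HH_class f : cochain f -> (forall s, hochschild f s = 0) ->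
  represents f (HH_class f).
Proof.
move=> cf df; rewrite /HH_class; case: pselect => [e|[]];
  last exact: represents_ex.
exact: svalP (cid e).
Qed.

Definition HH_rep x : seq A -> A := sval (cid (represents_surj x)).

Lemma HH_repP x : represents (HH_rep x) x.
Proof. exact: svalP (cid (represents_surj x)). Qed.

(** An operation on cochains that preserves cocycles and respects coboundaries acts on classes; its
    value does not depend on the chosen representative. *)
Lemma represents_map (T : (seq A -> A) -> (seq A -> A)) f x :
  (forall g, cochain g -> (forall s, hochschild g s = 0) ->
     cochain (T g) /\ forall s, hochschild (T g) s = 0) ->
  (forall g h, cochain g -> cochain h ->
     exists2 h', cochain h' &
     forall s, T (fun s => g s + hochschild h s) s = T g s + hochschild h' s) ->
  represents f x -> represents (T f) (HH_class (T (HH_rep x))).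
Proof.
move=> Tc Tb fx; have rx := HH_repP x.
have [cr dr] := represents_cocycle rx; have [cf df] := represents_cocycle fx.
have [cTr dTr] := Tc _ cr dr; have [cTf dTf] := Tc _ cf df.
have [h ch E] := (represents_eqP rx fx).1 erefl.
have [h' ch' E'] := Tb f h cf ch.
apply: (represents_cohomologous (represents_HH_class cTr dTr) cTf ch') => s.
by rewrite -E'; congr (T _ s); apply/funext.
Qed.

Lemma hochschild_size (G : nat -> k) f s :
  hochschild (fun t => G (size t).+1 *: f t) s = G (size s) *: hochschild f s.
Proof.
rewrite !hochschildE; have -> : rbar (fun t => G (size t).+1 *: f t) s
    = G (size s) *: rbar f s.
  elim: s G f => [|a s IH] G f /=; first by rewrite scaler0.
  rewrite (IH (fun n => G n.+1)); case: s {IH} => [|b s] /=; last by lin; ring.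
  by rewrite -scalerAl; lin; ring.
case: s => [|a s] /=; first by rewrite add0r addr0.
by rewrite -scalerAr; lin; ring.
Qed.

Definition component n f s : A := (size s == n)%:R *: f s.

Lemma homogeneous_component n f : homogeneous n (component n f).
Proof. by move=> s /negPf sn; rewrite /component sn scale0r. Qed.

Lemma component_id n f : homogeneous n f -> component n f =1 f.
Proof.
move=> hf s; rewrite /component; case: eqVneq => [_|/hf->];
  first exact: scale1r.
by rewrite scaler0.
Qed.

Lemma multilinear_component n f : multilinear f -> multilinear (component n f).
Proof. exact: (@multilinear_size _ _ (fun i => (i == n)%:R)). Qed.

Lemma homogeneous_cochain n f : multilinear f -> homogeneous n f -> cochain f.
Proof.
by move=> lf /homogeneous_bounded bf; split=> //; exists n.+1.
Qed.

Lemma cochain_component n f : cochain f -> cochain (component n f).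
Proof.
move=> [lf _]; apply: (@homogeneous_cochain n);
  first exact: multilinear_component.
exact: homogeneous_component.
Qed.

Lemma hochschild_component n f s :
  hochschild (component n f) s = component n.+1 (hochschild f) s.
Proof. exact: (hochschild_size (fun i => (i == n.+1)%:R)). Qed.

Lemma component0_hochschild f s : component 0 (hochschild f) s = 0.
Proof. by case: s => [|a s]; rewrite /component /= ?scaler0 ?scale0r. Qed.

Lemma component_sum N f s : bounded N f ->
  f s = \sum_(i < N) component i f s.
Proof.
move=> bf; case: (leqP N (size s)) => sN.
  by rewrite bf // big1 // => i _; rewrite /component bf // scaler0.
rewrite (bigD1 (Ordinal sN)) //= big1 ?addr0; last first.
  by move=> i; rewrite -val_eqE eq_sym => /negPf; rewrite /component /= => ->;
    rewrite scale0r.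
by rewrite /component eqxx scale1r.
Qed.

Lemma represents_sum N (F : nat -> seq A -> A) (y : nat -> HH A) :
  (forall i, represents (F i) (y i)) ->
  represents (fun s => \sum_(i < N) F i s) (\sum_(i < N) y i).
Proof.
move=> Fy; elim: N => [|N IH].
  rewrite big_ord0 (_ : (fun s => _) = (fun=> 0)); first exact: represents0.
  by apply/funext => s; rewrite big_ord0.
rewrite big_ord_recr /= addrC -[y N]scale1r.
have := represents_linear 1 (Fy N) IH; congr represents.
by apply/funext => s; rewrite big_ord_recr /= scale1r addrC.
Qed.

Lemma HH_degP n x : HH_deg n x <->
  exists2 f, represents f x & multilinear f /\ homogeneous n f.
Proof.
split=> [[f hf fx]|[f fx [_ hf]]]; last by exists f.
by exists f; rewrite //; have [[lf _] _] := represents_cocycle fx.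
Qed.

Lemma HH_grading : is_grading (@HH_deg k A).
Proof.
split=> [n|n c x y [f hf fx] [g hg gy]|x|N y yd E i iN].
- by exists (fun=> 0); [| exact: represents0].
- exists (fun s => c *: f s + g s); last exact: represents_linear.
  by move=> s sn; rewrite hf // hg // scaler0 addr0.
- have [f fx] := represents_surj x; have [cf df] := represents_cocycle fx.
  have [lf [N bf]] := cf; exists N.
  have cy i : represents (component i f) (HH_class (component i f)).
    apply: represents_HH_class; first exact: cochain_component.
    by move=> s; rewrite hochschild_component /component df scaler0.
  exists (fun i => HH_class (component i f)); split=> [i|].
    by exists (component i f); [exact: homogeneous_component | exact: cy].
  apply: (represents_inj fx); have := represents_sum N cy; congr represents.
  by apply/funext => s; rewrite -component_sum.
- have /choice[F Fy] : forall j, exists f, homogeneous j f /\ represents f (y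
  j).
    by move=> j; have [f hf fy] := yd j; exists f.
  have FS := represents_sum N (fun j => (Fy j).2); rewrite E in FS.
  have [h ch Eh] := (represents_eqP FS represents0).1 erefl.
  have Fi s : F i s = component i (hochschild h) s.
    rewrite /component -[hochschild h s]add0r -Eh scaler_sumr.
    rewrite (bigD1 (Ordinal iN)) //= big1 ?addr0; last first.
      move=> j; rewrite -val_eqE /= => ji.
      case: eqVneq => [si|_]; last by rewrite scale0r.
      by rewrite (Fy j).1 ?scaler0 // si eq_sym.
    by rewrite -[LHS](component_id (Fy i).1).
  apply/(represents_eqP (Fy i).2 represents0).
  (* There are no nonzero coboundaries in degree 0; in degree i.+1, the component of dh is the
     coboundary of the component of h of degree i. *)
  case: i iN Fi => [|i] iN Fi.
    exists 0; first exact: cochain0.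
    by move=> s; rewrite Fi component0_hochschild hochschild0 addr0.
  exists (component i h); first exact: cochain_component.
  by move=> s; rewrite Fi hochschild_component add0r.
Qed.

End Cohomology.

(** * The BV operator *)

Section BV.
Variables (k : fieldType) (A : falgType k) (lam : {scalar A}).
Hypothesis lamC : forall a b : A, lam (a * b) = lam (b * a).
Hypothesis lam_nondegenerate :
  forall a : A, (forall b : A, lam (b * a) = 0) -> a = 0.
Implicit Types (f g h F : seq A -> A) (a : A) (s t u v w : seq A).
Implicit Types (x y z : HH A) (m n p : nat).

Lemma linear_rotations f s : multilinear f -> linear ((rotations f)^~ s).
Proof.
move=> lf c a b; rewrite /rotations -splitsZ -splitsD;
  apply: eq_splits => u v _.
by rewrite lf; lin; ring.
Qed.

Lemma multilinear_rotations f a : multilinear f -> multilinear (rotations f a).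
Proof.
move=> lf; apply: (@multilinear_splits _ _
  (fun u v => (-1) ^+ (size v * (size u).+1) *: f (v ++ a :: u))) => [v|u].
- apply: (@multilinear_size _ _ (fun i => (-1) ^+ (size v * i.+1))
    (fun u => f (v ++ a :: u))).
  exact: (multilinear_cons _ (multilinear_cat _ lf)).
- apply: (@multilinear_size _ _ (fun i => (-1) ^+ (i * (size u).+1))
    (fun v => f (v ++ a :: u))).
  exact: multilinear_catr.
Qed.

Definition BV_op f := dual lam (rotations f).

Lemma BV_opP f a s : multilinear f -> lam (a * BV_op f s)
  = lam (rotations f a s).
Proof. by move=> lf; apply: dualP => //; apply: linear_rotations. Qed.

Lemma multilinear_BV_op f : multilinear f -> multilinear (BV_op f).
Proof.
move=> lf; apply: multilinear_dual => // [s|a]; first exact: linear_rotations.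
exact: multilinear_rotations.
Qed.

Lemma BV_op_inj f g s : multilinear f ->
  (forall a, lam (rotations f a s) = lam (a * g s)) -> BV_op f s = g s.
Proof.
by move=> lf E; apply: (lam_inj lam_nondegenerate) => a; rewrite BV_opP.
Qed.

Lemma bounded_BV_op n f : multilinear f -> bounded n.+1 f -> bounded n (BV_op
  f).
Proof.
move=> lf bf s ns; apply: (BV_op_inj (g := fun=> 0) lf) => a.
rewrite mulr0 /rotations -[X in lam X = _](_ : 0 = _) // -[LHS](splits0 s).
by apply: eq_splits => u v uv; rewrite bf ?scaler0 // size_cat /=; lia.
Qed.

Lemma homogeneous_BV_op n f : multilinear f -> homogeneous n.+1 f ->
  homogeneous n (BV_op f).
Proof.
move=> lf hf s ns; apply: (BV_op_inj (g := fun=> 0) lf) => a.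
rewrite mulr0 /rotations -[X in lam X = _](_ : 0 = _) // -[LHS](splits0 s).
by apply: eq_splits => u v uv; rewrite hf ?scaler0 // size_cat /=; lia.
Qed.

Lemma BV_op_homogeneous0 f s : multilinear f -> homogeneous 0 f -> BV_op f s
  = 0.
Proof.
move=> lf hf; apply: (BV_op_inj (g := fun=> 0) lf) => a.
rewrite mulr0 /rotations -[X in lam X = _](_ : 0 = _) // -[LHS](splits0 s).
by apply: eq_splits => u v uv; rewrite hf ?scaler0 // size_cat addnS.
Qed.

Lemma cochain_BV_op f : cochain f -> cochain (BV_op f).
Proof.
move=> [lf [n bf]]; split; first exact: multilinear_BV_op.
by exists n; apply: bounded_BV_op => // s /ltnW; apply: bf.
Qed.

Lemma BV_op_linear c f g s : multilinear f -> multilinear g ->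
  BV_op (fun t => c *: f t + g t) s = c *: BV_op f s + BV_op g s.
Proof.
move=> lf lg; apply: (BV_op_inj (g := fun s => c *: BV_op f s + BV_op g s)) =>
  [|a].
  by apply: multilinearD => //; apply: multilinearZ.
rewrite mulrDr -scalerAr !scalarE !BV_opP // -!scalarE; congr (lam _).
by rewrite /rotations -splitsZ -splitsD; apply: eq_splits => u v _; lin; ring.
Qed.

Lemma hochschild_BV_op f s : multilinear f ->
  hochschild (BV_op f) s = - BV_op (hochschild f) s.
Proof.
move=> lf; apply: (lam_inj lam_nondegenerate) => a.
rewrite (lam_hochschild lamC (K := rotations f)); last by move=> b t;
  rewrite BV_opP.
rewrite lam_cyclic_hochschild_rotations // mulrN scalarE BV_opP //.
exact: multilinear_hochschild.
Qed.

Lemma normalized_BV_op f : multilinear f -> normalized f -> normalized (BV_op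
  f).
Proof.
move=> lf nf s s1; apply: (BV_op_inj (g := fun=> 0) lf) => a.
rewrite mulr0 /rotations /splits big1 ?raddf0 // => i _.
rewrite nf ?scaler0 // mem_cat inE orbCA.
by move: s1; rewrite -{1}(cat_take_drop i s) mem_cat orbC => ->; rewrite orbT.
Qed.

(** lam of a value of [BV_op f] is a sum of rotations of a word containing 1, on each of which f
    vanishes. *)
Lemma BV_op_BV_op f s : multilinear f -> normalized f -> BV_op (BV_op f) s = 0.
Proof.
move=> lf nf.
apply: (BV_op_inj (g := fun=> 0)) => [|a]; first exact: multilinear_BV_op.
rewrite mulr0 -(splits0 s); apply: eq_lam_splits => u v _.
rewrite !scalarE -[BV_op f _]mul1r BV_opP // /rotations /splits big1 ?raddf0
  ?mulr0 // => i _.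
by rewrite nf ?scaler0 // mem_cat inE eqxx orbT.
Qed.

Lemma cyclic_sumE f a s : cyclic_sum f (a :: s) = rotations f a s.
Proof.
(* Cutting s after j letters corresponds to the right rotation by [size s - j], hence the reversal
   of the index. *)
rewrite /cyclic_sum /rotations /splits (reindex_inj rev_ord_inj);
  apply: eq_bigr => j _ /=.
have js : (j <= size s)%N by rewrite -ltnS.
rewrite subSS size_drop (size_takel js); congr (_ *: f _).
  move: (nat_of_ord j) js => i; move: (size s) => l /subnKC <-; rewrite addKn.
  by move: (l - i)%N => r; sring.
by rewrite /rotr /= subSn ?leq_subr // subKn // /rot /=.
Qed.

Lemma linear_insertion_head n f v g t : multilinear f ->
  linear (fun a => insertion n (fun r => f (v ++ a :: r)) g t).
Proof.
by move=> lf c a b; rewrite -insertionZ -insertionD;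
  apply: eq_insertion => x r; rewrite lf.
Qed.

Lemma linear_rotation_homotopy n f g s : multilinear f -> linear
  ((rotation_homotopy n f g)^~ s).
Proof.
move=> lf c a b; rewrite /rotation_homotopy -splitsZ -splitsD;
  apply: eq_splits => t v _.
by rewrite (linear_insertion_head _ _ _ _ lf); lin; ring.
Qed.

Lemma multilinear_rotation_homotopy n f g a : multilinear f -> multilinear g ->
  multilinear (rotation_homotopy n f g a).
Proof.
move=> lf lg; apply: (@multilinear_splits _ _ (fun t v =>
  (-1) ^+ (size v * (size t + n)) *: insertion n (fun r => f (v ++ a :: r)) g
    t))
  => [v|t].
- apply: (@multilinear_size _ _ (fun i => (-1) ^+ (size v * (i + n)))
    (insertion n (fun r => f (v ++ a :: r)) g)).
  exact: multilinear_insertion (multilinear_cons _ (multilinear_cat _ lf)) lg.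
- apply: (@multilinear_size _ _ (fun i => (-1) ^+ (i * (size t + n)))
    (fun v => insertion n (fun r => f (v ++ a :: r)) g t)) => v v' c x y.
  rewrite -insertionZ -insertionD; apply: eq_insertion => b r.
  exact: (multilinear_catr _ lf).
Qed.

Definition BV_homotopy n f g := dual lam (rotation_homotopy n f g).

Lemma cochain_BV_homotopy m n f g : multilinear f -> multilinear g ->
  homogeneous m f -> homogeneous n g -> cochain (BV_homotopy n f g).
Proof.
move=> lf lg hf hg; split.
  apply: multilinear_dual => // [s|a]; first exact: linear_rotation_homotopy.
  exact: multilinear_rotation_homotopy.
exists (m + n).+1 => s ms; apply: (lam_inj lam_nondegenerate) => a.
rewrite dualP // => [|t]; last exact: linear_rotation_homotopy.
rewrite mulr0 -(splits0 s); congr (lam _); apply: eq_splits => t v tv.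
have lF : multilinear (fun r => f (v ++ a :: r)).
  exact: (multilinear_cons _ (multilinear_cat _ lf)).
case: (leqP m (size v)) => mv.
  by rewrite insertion_vanish ?scaler0 // => x r; apply: hf;
    rewrite size_cat /=; lia.
rewrite (@bounded_insertion _ _ (m - size v)%N n) ?scaler0 //; last by lia.
by move=> r mr; rewrite hf // size_cat /=; lia.
Qed.

Definition bracket m n f g s : A :=
  (-1) ^+ (m * n + n.+1) *: insertion n f g s + (-1) ^+ m.+1 *: insertion m g f
    s.

Section Cocycles.
Variables (m n : nat) (f g : seq A -> A).
Hypotheses (lf : multilinear f) (hf : homogeneous m f).
Hypotheses (lg : multilinear g) (hg : homogeneous n g).
Hypotheses (df : forall s, hochschild f s = 0) (dg : forall s,
  hochschild g s = 0).

(** Both halves of the rotations of f u g are evaluated by the homotopy, once for (f, g) and once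
    for (g, f); the two insertions form the bracket. *)
Lemma BV_op_cup s :
  BV_op (cup f g) s
  = bracket m n f g s + (-1) ^+ (m * n + n) *: cup g (BV_op f) s
    + (-1) ^+ m *: cup f (BV_op g) s
    + hochschild (fun t => - (-1) ^+ (m * n) *: BV_homotopy n f g t + -
      BV_homotopy m g f t) s.
Proof.
apply: (lam_inj lam_nondegenerate) => a; rewrite BV_opP;
  last exact: multilinear_cup.
rewrite (lam_rotations_cup lamC hf hg) hochschildD hochschildZ.
have -> : hochschild (fun t => - BV_homotopy m g f t) s = - hochschild
  (BV_homotopy m g f) s.
  rewrite -scaleN1r -hochschildZ; congr (hochschild _ s).
  by apply/funext => t; rewrite scaleN1r.
have C f' g' t : multilinear f' ->
   lam (splits (fun w r => rotations f' (a * g' w) r) t) = lam (a * cup g'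
     (BV_op f') t).
  move=> lf'; rewrite cupE -splitsMl; apply: eq_lam_splits => w r _.
  by rewrite mulrA BV_opP.
have H1 : lam (a * hochschild (BV_homotopy n f g) s) = lam (cyclic_hochschild
  (rotation_homotopy n f g) a s).
  by apply: (lam_hochschild lamC) => b t; apply: dualP => // r;
    exact: linear_rotation_homotopy.
have H2 : lam (a * hochschild (BV_homotopy m g f) s) = lam (cyclic_hochschild
  (rotation_homotopy m g f) a s).
  by apply: (lam_hochschild lamC) => b t; apply: dualP => // r;
    exact: linear_rotation_homotopy.
rewrite (lam_cyclic_hochschild_homotopy lamC lf hf hg df dg) C // in H1.
rewrite (lam_cyclic_hochschild_homotopy lamC lg hg hf dg df) C // in H2.
rewrite !mulrDr mulrN -!scalerAr !scalarE H1 H2 (mulnC n m).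
by sring.
Qed.

End Cocycles.

Section Operations.

Lemma BV_op0 s : BV_op (fun=> 0) s = 0.
Proof.
have l0 : multilinear (fun=> 0 : A) by move=> *; rewrite scaler0 addr0.
apply: (BV_op_inj (g := fun=> 0) l0) => a; rewrite mulr0.
congr (lam _); rewrite -[RHS](splits0 s); apply: eq_splits => u v _.
by rewrite scaler0.
Qed.

Definition HH_Delta x : HH A := HH_class (BV_op (HH_rep x)).

Lemma represents_Delta f x : represents f x -> represents (BV_op f) (HH_Delta
  x).
Proof.
move=> fx; apply: (represents_map (T := BV_op)) => // [g cg dg|g h cg ch].
  split=> [|s]; first exact: cochain_BV_op.
  by rewrite hochschild_BV_op ?(funext dg) ?BV_op0 ?oppr0 //; case: cg.
(* The sign appears because [BV_op] anticommutes with the differential. *)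
exists (fun s => -1 *: BV_op h s).
  have [lDh [N bDh]] := cochain_BV_op ch; split; first exact: multilinearZ.
  by exists N => s Ns; rewrite bDh ?scaler0.
move=> s; have [lg _] := cg; have [lh _] := ch.
rewrite hochschildZ hochschild_BV_op // scaleN1r opprK addrC.
rewrite -[X in X + _](scale1r) -BV_op_linear //;
  last exact: multilinear_hochschild.
by congr (BV_op _ s); apply/funext => t; rewrite scale1r addrC.
Qed.

Definition HH_mul x y : HH A := HH_class (cup (HH_rep x) (HH_rep y)).

Lemma cochain_cup f g : cochain f -> cochain g -> cochain (cup f g).
Proof.
move=> [lf [m bf]] [lg [n bg]]; split; first exact: multilinear_cup.
by exists (m + n)%N; apply: bounded_cup.
Qed.

Lemma cochain_sign f : cochain f -> cochain (fun t => (-1) ^+ size t *: f t).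
Proof.
move=> [lf [m bf]]; split; first exact: (multilinear_size (fun i => (-1) ^+ i)).
by exists m => s ms; rewrite bf ?scaler0.
Qed.

Lemma hochschild_sign f s : (forall t, hochschild f t = 0) ->
  hochschild (fun t => (-1) ^+ size t *: f t) s = 0.
Proof.
move=> df; rewrite -[RHS](scaler0 _ ((-1) ^+ (size s).+1)) -(df s).
rewrite -(hochschild_size (fun i => (-1) ^+ i.+1)); congr (hochschild _ s).
by apply/funext => t; congr (_ *: _); sring.
Qed.

Lemma cup0l g s : cup (fun=> 0) g s = 0.
Proof. by rewrite cupE -[RHS](splits0 s); apply: eq_splits => u v _;
  rewrite mul0r. Qed.

Lemma cup0r f s : cup f (fun=> 0) s = 0.
Proof. by rewrite cupE -[RHS](splits0 s); apply: eq_splits => u v _;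
  rewrite mulr0. Qed.

Lemma cochainD f g : cochain f -> cochain g -> cochain (fun s => f s + g s).
Proof.
move=> cf cg; have := cochain_linear 1 cf cg; congr cochain.
by apply/funext => s; rewrite !fctE scale1r.
Qed.

Lemma cochainZ c f : cochain f -> cochain (fun s => c *: f s).
Proof.
move=> cf; have := cochain_linear c cf (cochain0 A); congr cochain.
by apply/funext => s; rewrite !fctE addr0.
Qed.

Lemma hochschild_cup0 f g s : (forall t, hochschild f t = 0) ->
  (forall t, hochschild g t = 0) -> hochschild (cup f g) s = 0.
Proof.
by move=> df dg; rewrite hochschild_cup (funext df) (funext dg) cup0l cup0r
  addr0.
Qed.

Lemma represents_cup f g x y :
  represents f x -> represents g y -> represents (cup f g) (HH_mul x y).
Proof.
move=> fx gy; have rx := HH_repP x; have qy := HH_repP y.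
set r := HH_rep x in rx; set q := HH_rep y in qy.
have [cr dr] := represents_cocycle rx; have [cf df] := represents_cocycle fx.
have [cq dq] := represents_cocycle qy; have [cg dg] := represents_cocycle gy.
have [h ch Eh] := (represents_eqP rx fx).1 erefl.
have [l cl El] := (represents_eqP qy gy).1 erefl.
have R : represents (cup r q) (HH_mul x y).
  apply: represents_HH_class; first exact: cochain_cup.
  by move=> s; apply: hochschild_cup0.
(* With r = f + dh and q = g + dl, the difference of the products is dh u q + f u dl. The sign put
   on f compensates the one in the Leibniz rule. *)
apply: (represents_cohomologous
  (h := fun s => cup h q s + cup (fun t => (-1) ^+ size t *: f t) l s) R).
- exact: cochain_cup.
- by apply: cochainD; apply: cochain_cup => //; apply: cochain_sign.
- move=> s; rewrite hochschildD !hochschild_cup (funext dq) cup0r addr0.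
  rewrite (funext (fun t => hochschild_sign t df)) cup0l add0r !cupE -!splitsD.
  apply: eq_splits => u v _; rewrite Eh El scalerA -exprD.
  by rewrite addnn -mul2n exprM sqrrN expr1n expr1n scale1r !mulrDl mulrDr;
    lin; ring.
Qed.

Lemma HH_mul_linearl y : linear (HH_mul^~ y).
Proof.
move=> c x x'; have [f fx] := represents_surj x;
  have [f' fx'] := represents_surj x'.
have [g gy] := represents_surj y.
have L := represents_cup (represents_linear c fx fx') gy.
have R := represents_linear c (represents_cup fx gy) (represents_cup fx' gy).
apply: (represents_inj L); move: R; congr represents; apply/funext => s.
by rewrite cupDl cupZl.
Qed.

Lemma HH_mul_linearr x : linear (HH_mul x).
Proof.
move=> c y y'; have [f fy] := represents_surj y;
  have [f' fy'] := represents_surj y'.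
have [g gx] := represents_surj x.
have L := represents_cup gx (represents_linear c fy fy').
have R := represents_linear c (represents_cup gx fy) (represents_cup gx fy').
apply: (represents_inj L); move: R; congr represents; apply/funext => s.
rewrite !cupE -splitsZ -splitsD; apply: eq_splits => u v _.
by rewrite mulrDr scalerAr.
Qed.

Lemma HH_mulA : associative HH_mul.
Proof.
move=> x y z; have [f fx] := represents_surj x;
  have [g gy] := represents_surj y.
have [h hz] := represents_surj z.
have L := represents_cup fx (represents_cup gy hz).
apply: (represents_inj L); have := represents_cup (represents_cup fx gy) hz.
congr represents; apply/funext => s; rewrite [LHS]cupE [RHS]cupE.
rewrite (eq_splits (G := fun t w => splits (fun u v => f u * g v * h w) t));
  last first.
  by move=> u v _; rewrite splitsMr.
rewrite splits_assoc; apply: eq_splits => u v _; rewrite cupE -splitsMl.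
by apply: eq_splits => *; rewrite mulrA.
Qed.

Lemma cochain_insertion m n f g : multilinear f -> multilinear g ->
  homogeneous m f -> homogeneous n g -> cochain (insertion n f g).
Proof.
move=> lf lg hf hg; split; first exact: multilinear_insertion.
exists (m.+1 + n)%N; apply: bounded_insertion => //; exact: homogeneous_bounded.
Qed.

Lemma HH_mulC m n x y : HH_deg m x -> HH_deg n y ->
  HH_mul x y = (-1) ^+ (m * n) *: HH_mul y x.
Proof.
move=> /HH_degP[f fx [lf hf]] /HH_degP[g gy [lg hg]].
have [_ df] := represents_cocycle fx; have [_ dg] := represents_cocycle gy.
have L := represents_cup fx gy.
have R := represents_linear ((-1) ^+ (m * n)) (represents_cup gy fx)
  (represents0 A).
rewrite addr0 in R; apply/(represents_eqP L R).
exists (fun s => - (-1) ^+ (m * n + n) *: insertion n f g s).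
  by apply: cochainZ; apply: cochain_insertion hf hg.
move=> s; rewrite hochschildZ (hochschild_insertion hg dg) // addr0.
have -> : twisted_cup n f g s = (-1) ^+ (m * n) *: cup f g s.
  rewrite cupE -splitsZ; apply: eq_splits => u v _.
  by have /orP[/eqP->|/eqP->] := homogeneousP u hf; rewrite ?mul0r ?scaler0.
by lin; sring.
Qed.

Lemma HH_Delta_linear : linear HH_Delta.
Proof.
move=> c x y; have [f fx] := represents_surj x;
  have [g gy] := represents_surj y.
have [[lf _] _] := represents_cocycle fx; have [[lg _] _] := represents_cocycle
  gy.
have L := represents_Delta (represents_linear c fx gy).
apply: (represents_inj L).
have := represents_linear c (represents_Delta fx) (represents_Delta gy).
by congr represents; apply/funext => s; rewrite BV_op_linear.
Qed.

Lemma HH_Delta_deg0 x : HH_deg 0 x -> HH_Delta x = 0.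
Proof.
move=> /HH_degP[f fx [lf hf]]; apply: (represents_inj (represents_Delta fx)).
have := represents0 A; congr represents.
by apply/funext => s; rewrite BV_op_homogeneous0.
Qed.

Lemma HH_Delta_degS n x : HH_deg n.+1 x -> HH_deg n (HH_Delta x).
Proof.
move=> /HH_degP[f fx [lf hf]]; exists (BV_op f); last exact: represents_Delta.
exact: homogeneous_BV_op.
Qed.

Lemma normalized_rep x : exists2 f, normalized f & represents f x.
Proof.
have [f fx] := represents_surj x; have [cf df] := represents_cocycle fx.
have [h ch nh] := normalized_ex cf df.
exists (fun s => f s + hochschild h s) => //.
apply: (represents_cohomologous (h := fun s => -1 *: h s) fx).
- apply: cochainD => //; have [lh [N bh]] := ch.
  split; first exact: multilinear_hochschild.
  by exists N.+1; apply: bounded_hochschild.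
- exact: cochainZ.
- by move=> s; rewrite hochschildZ; lin; ring.
Qed.

Lemma HH_DeltaK x : HH_Delta (HH_Delta x) = 0.
Proof.
have [f nf fx] := normalized_rep x; have [[lf _] _] := represents_cocycle fx.
apply: (represents_inj (represents_Delta (represents_Delta fx))).
have := represents0 A; congr represents.
by apply/funext => s; rewrite BV_op_BV_op.
Qed.

End Operations.
End BV.

(** * The bracket *)

Section Bracket.
Variables (k : fieldType) (A : falgType k) (lam : {scalar A}).
Hypothesis lamC : forall a b : A, lam (a * b) = lam (b * a).
Hypothesis lam_nondegenerate :
  forall a : A, (forall b : A, lam (b * a) = 0) -> a = 0.
Implicit Types (f g h F : seq A -> A) (a : A) (s t u v w : seq A).
Implicit Types (x y z : HH A) (m n p : nat).

Local Notation Delta := (HH_Delta lam).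

(** f o g has degree m + n - 1; adding 1 to the length avoids truncated subtraction when m = n =
    0. *)
Lemma homogeneous_insertion m n f g s : multilinear f -> homogeneous m f ->
  homogeneous n g -> ((size s).+1 != m + n)%N -> insertion n f g s = 0.
Proof.
move=> + + hg; elim: s m f => [|a s IH] m f lf hf /= ms.
all: rewrite [insert_head _ _ _](_ : _ = 0) ?add0r.
- by [].
- rewrite -[RHS](splits0 [::]); apply: eq_splits => w v /= wv.
  have /orP[/eqP wn|/eqP->] := homogeneousP w hg; last exact: head0.
  by apply: hf => /=; move: ms; lia.
- case: m hf ms => [|m] hf ms.
    by rewrite insertion_vanish ?scaler0 // => x t; apply: hf.
  rewrite (IH m) ?scaler0 //; first exact: multilinear_cons.
  by move=> t tm; rewrite hf.
- rewrite -[RHS](splits0 (a :: s)); apply: eq_splits => w v /= wv.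
  have /orP[/eqP wn|/eqP->] := homogeneousP w hg; last exact: head0.
  by apply: hf => /=; move: ms; lia.
Qed.

Definition deviation m x y : HH A :=
  Delta (HH_mul x y) - HH_mul (Delta x) y - (-1) ^+ m *: HH_mul x (Delta y).

Lemma HH_mul0l y : HH_mul 0 y = 0.
Proof. by have := HH_mul_linearl y (-1) 0 0; rewrite scaler0 addr0 scaleN1r
  addNr. Qed.

Lemma HH_mulZl c x y : HH_mul (c *: x) y = c *: HH_mul x y.
Proof. by rewrite -[c *: x]addr0 HH_mul_linearl HH_mul0l addr0. Qed.

Lemma HH_mul0r x : HH_mul x 0 = 0.
Proof. by have := HH_mul_linearr x (-1) 0 0; rewrite scaler0 addr0 scaleN1r
  addNr. Qed.

Lemma represents_deviation m n f g x y :
  homogeneous m f -> homogeneous n g -> represents f x -> represents g y ->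
  represents (bracket m n f g) (deviation m x y).
Proof.
move=> hf hg fx gy.
have [[lf _] df] := represents_cocycle fx; have [[lg _] dg] :=
  represents_cocycle gy.
have -> : deviation m x y = - (-1) ^+ m *: HH_mul x (Delta y)
   + (- (-1) ^+ (m * n + n) *: HH_mul y (Delta x) + Delta (HH_mul x y)).
  rewrite !scaleNr [RHS]addrC [- _ + _]addrC; congr (_ - _ - _).
  (* In degree 0, Delta x is 0; otherwise it has degree m, and commutativity turns y (Delta x) into
     (Delta x) y. *)
  case: m hf => [|m] hf.
    by rewrite (HH_Delta_deg0 lamC lam_nondegenerate) ?HH_mul0l ?HH_mul0r
      ?scaler0 //; exists f.
  have dx : HH_deg m (Delta x) by apply: HH_Delta_degS => //; exists f.
  by rewrite (HH_mulC dx (n := n)); [congr (_ *: _); sring | exists g].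
have Dfx := represents_Delta lamC lam_nondegenerate fx.
have Dgy := represents_Delta lamC lam_nondegenerate gy.
have Dfg := represents_Delta lamC lam_nondegenerate (represents_cup fx gy).
apply: (represents_cohomologous (h := fun t =>
    - (-1) ^+ (m * n) *: BV_homotopy lam n f g t + - BV_homotopy lam m g f t)
  (represents_linear (- (-1) ^+ m) (represents_cup fx Dgy)
    (represents_linear (- (-1) ^+ (m * n + n)) (represents_cup gy Dfx) Dfg))).
- by apply: cochainD; apply: cochainZ; [apply: cochain_insertion hf hg | apply:
  cochain_insertion hg hf].
- apply: cochainD; first by apply: cochainZ; apply: cochain_BV_homotopy hf hg.
  rewrite (_ : (fun t => _) = (fun t => -1 *: BV_homotopy lam m g f t)).
    by apply: cochainZ; apply: cochain_BV_homotopy hg hf.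
  by apply/funext => t; rewrite scaleN1r.
- by move=> s; rewrite (BV_op_cup lamC lam_nondegenerate lf hf lg hg df dg s);
  lin; ring.
Qed.

Lemma cupDr f g1 g2 s :
  cup f (fun t => g1 t + g2 t) s = cup f g1 s + cup f g2 s.
Proof. by rewrite !cupE -splitsD; apply: eq_splits => u v _;
  rewrite mulrDr. Qed.

Lemma cupZr c f g s : cup f (fun t => c *: g t) s = c *: cup f g s.
Proof. by rewrite !cupE -splitsZ; apply: eq_splits => u v _;
  rewrite scalerAr. Qed.

(** The deviation is the bracket. The half f o (g u h) obeys the rule up to the coboundary of f{g,
    h}, and the half (g u h) o f obeys it exactly, by [insertion_cup]. *)
Lemma deviation_mul m n p x y z : HH_deg m x -> HH_deg n y -> HH_deg p z ->
  deviation m x (HH_mul y z)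
  = (-1) ^+ (n * m.+1) *: HH_mul y (deviation m x z) + HH_mul (deviation m x y)
    z.
Proof.
move=> [f hf fx] [g hg gy] [h hh hz].
have [[lf _] df] := represents_cocycle fx; have [[lg _] dg] :=
  represents_cocycle gy.
have [[lh _] dh] := represents_cocycle hz.
have L := represents_deviation hf (homogeneous_cup hg hh) fx (represents_cup gy
  hz).
have R := represents_linear ((-1) ^+ (n * m.+1))
  (represents_cup gy (represents_deviation hf hh fx hz))
  (represents_cup (represents_deviation hf hg fx gy) hz).
apply/(represents_eqP L R).
exists (fun s => (-1) ^+ (m * (n + p)).+1 *: brace n p f g h s).
  apply: cochainZ; split; first exact: multilinear_brace.
  exists (m.+1 + n + p)%N; apply: bounded_brace => //.
  exact: homogeneous_bounded.
move=> s; rewrite hochschildZ (hochschild_brace hg hh dg dh) //.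
have -> : twisted_cup p (insertion n f g) h s = (-1) ^+ (p * (m + n).+1) *: cup
  (insertion n f g) h s.
  rewrite cupE -splitsZ; apply: eq_splits => u v _.
  case: (eqVneq (size u).+1 (m + n)%N) => [<-|um].
    by congr (_ *: _); sring.
  by rewrite (homogeneous_insertion lf hf hg um) mul0r !scaler0.
rewrite /bracket cupDr !cupZr cupDl !cupZl insertion_cup.
have -> : splits (fun u v => (-1) ^+ (size u * m.+1) *: (g u * insertion m h f
  v)) s
   = (-1) ^+ (n * m.+1) *: cup g (insertion m h f) s.
  rewrite cupE -splitsZ; apply: eq_splits => u v _.
  by have /orP[/eqP->|/eqP->] := homogeneousP u hg; rewrite ?mul0r ?scaler0.
by lin; sring.
Qed.

Lemma HH_mul_combr x y1 y2 y3 c :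
  HH_mul x (y1 - y2 - c *: y3)
  = HH_mul x y1 - HH_mul x y2 - c *: HH_mul x y3.
Proof.
rewrite -scaleNr addrC (HH_mul_linearr x) addrC scaleNr; congr (_ - _).
by rewrite -scaleN1r addrC (HH_mul_linearr x) addrC scaleN1r.
Qed.

Lemma HH_mul_combl y x1 x2 x3 c :
  HH_mul (x1 - x2 - c *: x3) y
  = HH_mul x1 y - HH_mul x2 y - c *: HH_mul x3 y.
Proof.
rewrite -scaleNr addrC (HH_mul_linearl y) addrC scaleNr; congr (_ - _).
by rewrite -scaleN1r addrC (HH_mul_linearl y) addrC scaleN1r.
Qed.

(** [deviation_mul] with its deviations expanded and the factors reordered by commutativity; the two
    terms containing x y (Delta z), up to order, combine with those of x (Delta (y z)) and (Delta x)
    y z. *)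
Lemma seven_term m n p x y z : HH_deg m x -> HH_deg n y -> HH_deg p z ->
  Delta (HH_mul (HH_mul x y) z)
  = HH_mul (Delta (HH_mul x y)) z + (-1) ^+ m *: HH_mul x (Delta (HH_mul y z))
    + (-1) ^+ (m.+1 * n) *: HH_mul y (Delta (HH_mul x z))
    - HH_mul (HH_mul (Delta x) y) z
    - (-1) ^+ m *: HH_mul (HH_mul x (Delta y)) z
    - (-1) ^+ (m + n) *: HH_mul (HH_mul x y) (Delta z).
Proof.
move=> dx dy dz; rewrite -(HH_mulA x y z).
have -> : Delta (HH_mul x (HH_mul y z)) = (-1) ^+ (n * m.+1) *: HH_mul y
  (deviation m x z)
   + HH_mul (deviation m x y) z + HH_mul (Delta x) (HH_mul y z)
   + (-1) ^+ m *: HH_mul x (Delta (HH_mul y z)).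
  by rewrite -(deviation_mul dx dy dz) /deviation [RHS]addrAC !subrK.
rewrite /deviation HH_mul_combr HH_mul_combl !scalerBr !scalerA !HH_mulA.
have -> : (-1) ^+ (n * m.+1) *: HH_mul (HH_mul y (Delta x)) z
        = HH_mul (HH_mul (Delta x) y) z.
  case: m dx => [|m] dx.
    by rewrite (HH_Delta_deg0 lamC lam_nondegenerate dx) HH_mul0r !HH_mul0l
      scaler0.
  have dDx : HH_deg m (Delta x) by apply: HH_Delta_degS dx.
  by rewrite (HH_mulC dDx dy) HH_mulZl; congr (_ *: _); sring.
have -> : ((-1) ^+ (n * m.+1) * (-1) ^+ m) *: HH_mul (HH_mul y x) (Delta z)
        = (-1) ^+ (m + n) *: HH_mul (HH_mul x y) (Delta z).
  by rewrite (HH_mulC dx dy) HH_mulZl scalerA; congr (_ *: _); sring.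
rewrite [(n * m.+1)%N]mulnC [LHS](AC (3*3*1*1) (4*8*1*2*6*3*(5*7))).
by rewrite /= addNr addr0.
Qed.

Lemma HH_BV_algebra : BV_algebra (@HH_deg k A) (@HH_mul k A) Delta.
Proof.
split.
- split; first exact: HH_grading.
  + exact: HH_mul_linearl.
  + exact: HH_mul_linearr.
  + exact: HH_mulA.
  + move=> m n x y [f hf fx] [g hg gy]; exists (cup f g).
      exact: homogeneous_cup.
    exact: represents_cup.
  + exact: HH_mulC.
- exact: HH_Delta_linear.
- exact: HH_Delta_deg0.
- exact: HH_Delta_degS.
- exact: HH_DeltaK.
- exact: seven_term.
Qed.

Lemma represents_gerstenhaber m n f g x y :
  homogeneous m f -> homogeneous n g -> represents f x -> represents g y ->
  represents (gerstenhaber m n f g)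
    ((-1) ^+ (m.+1 * n.+1) *: BV_bracket (@HH_mul k A) Delta m x y).
Proof.
move=> hf hg fx gy.
have [[lf _] _] := represents_cocycle fx; have [[lg _] _] := represents_cocycle
  gy.
rewrite /BV_bracket scalerA -/(deviation m x y).
have := represents_linear ((-1) ^+ (m.+1 * n.+1) * (-1) ^+ m)
  (represents_deviation hf hg fx gy) (represents0 A).
rewrite addr0; congr represents; apply/funext => s.
rewrite addr0 /gerstenhaber !fctE (circE _ lf hg) (circE _ lg hf) /bracket.
by lin; sring.
Qed.

End Bracket.

(* The sign (-1)^((m+1)(n+1)) is the universal one relating the two brackets. *)
Theorem corollary3p7 (k : fieldType) (A : falgType k) (eta : {biscalar A})
    (eta_nondegenerate : forall a : A, (forall b : A, eta a b = 0) -> a = 0)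
    (eta_symmetric : forall a b : A, eta a b = eta b a)
    (eta_invariant : forall a b c : A, eta (a * b) c = eta a (b * c)) :
  exists (mul : HH A -> HH A -> HH A) (Delta : HH A -> HH A),
    [/\ induced_by_cup mul,
        induced_by_BV_dual eta Delta,
        BV_algebra (@HH_deg k A) mul Delta
      & forall (m n : nat) (f g : seq A -> A) (x y : HH A),
          homogeneous m f -> homogeneous n g ->
          represents f x -> represents g y ->
          represents (gerstenhaber m n f g)
            ((-1) ^+ (m.+1 * n.+1) *: BV_bracket mul Delta m x y)].
Proof.
(* By invariance lam (a * b) = eta a b, so symmetry makes [lam] a trace and the non-degeneracy of
   eta becomes that of [lam]. *)
pose lam : {scalar A} := eta 1.
have lamE a b : lam (a * b) = eta a b by rewrite -[LHS]/(eta 1 (a * b))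
  -eta_invariant mul1r.
have lamC a b : lam (a * b) = lam (b * a) by rewrite !lamE eta_symmetric.
have lam_nd (a : A) : (forall b : A, lam (b * a) = 0) -> a = 0.
  move=> H; apply: eta_nondegenerate => b.
  by rewrite eta_symmetric -lamE H.
exists (@HH_mul k A), (HH_Delta lam); split.
- by move=> f g x y; apply: represents_cup.
- split=> [x|f x nf fx]; first exact: normalized_rep.
  have [[lf _] _] := represents_cocycle fx.
  exists (BV_op lam f); last by split; [exact: normalized_BV_op | exact:
    represents_Delta].
  by move=> a s; rewrite -lamE BV_opP // cyclic_sumE.
- exact: HH_BV_algebra.
- by move=> m n f g x y; apply: represents_gerstenhaber.
Qed.
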